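(* Let $\rho_{\Pi}\colon\hat{\Pi}\to\mathbb{A}_{\Pi}^{10}$ be the natural projection. The $\rho_{\Pi}$-fibers over points of the complement of $\{\mathcal{H}'=0\}$ in $\{4t_1^3+27t_2^2\neq0\}\times\mathbb{A}(L)$ are isomorphic to $\mathbb{P}^2\times\mathbb{P}^2$, and the $\rho_{\Pi}$-fibers over points of a nonempty subset of $\{\mathcal{H}'=0\}$ are isomorphic to $\mathbb{P}^{2,2}$.
   Context: We work over $\mathbb{C}$. Let $\mathbb{A}^{19}$ have coordinates $p_1,p_2,p_3,p_4,u,v,t_1,t_2$, $L_{123},L_{124},L_{125},L_{126},L_{135},L_{136},L_{245},L_{246}$, $s_1,s_2,s_3$. Abbreviate $\Delta=p_1p_4-p_2p_3$, $\lambda(X,Y,Z)=L_{136}X+L_{245}Y+L_{246}Z$, $\mu(X,Y,Z)=L_{135}X+L_{136}Y+L_{245}Z$, $U_1=p_1^2+t_1p_2^2+p_2u$, $U_2=2p_1p_3+2t_1p_2p_4+p_4u+p_2v$, $U_3=p_3^2+t_1p_4^2+p_4v$, $I_1=t_2p_2^2+p_1u$, $I_2=2t_2p_2p_4+p_3u+p_1v$, $I_3=t_2p_4^2+p_3v$, $W_1=t_1p_2u-t_2p_1p_2+u^2$, $W_2=t_1(p_4u+p_2v)-t_2(p_2p_3+p_1p_4)+2uv$, $W_3=t_1p_4v-t_2p_3p_4+v^2$, $\kappa_1=L_{135}L_{245}-L_{136}^2$, $\kappa_2=L_{135}L_{246}-L_{136}L_{245}$, $\kappa_3=L_{136}L_{246}-L_{245}^2$.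 Then $\Pi_{\mathbb{A}}^{15}\subset\mathbb{A}^{19}$ is the affine scheme defined by the nine polynomials \begin{align*} F_1&=us_1-p_1s_2-p_2s_3-L_{126}\Delta-\lambda(U_1,U_2,U_3),\\ F_2&=vs_1-p_3s_2-p_4s_3+L_{125}\Delta+\mu(U_1,U_2,U_3),\\ F_3&=-t_2p_2s_1+(u+t_1p_2)s_2-p_1s_3-L_{124}\Delta-\lambda(I_1,I_2,I_3),\\ F_4&=-t_2p_4s_1+(v+t_1p_4)s_2-p_3s_3+L_{123}\Delta+\mu(I_1,I_2,I_3),\\ F_5&=-t_2p_1s_1+(t_1p_1-t_2p_2)s_2+(u+t_1p_2)s_3+L_{123}U_1+L_{124}(p_1p_3+t_1p_2p_4+p_2v)\\&\quad-L_{125}I_1-L_{126}(t_2p_2p_4+p_1v)-\lambda(W_1,W_2,W_3),\\ F_6&=-t_2p_3s_1+(t_1p_3-t_2p_4)s_2+(v+t_1p_4)s_3+L_{123}(p_1p_3+t_1p_2p_4+p_4u)+L_{124}U_3\\&\quad-L_{125}(t_2p_2p_4+p_3u)-L_{126}I_3+\mu(W_1,W_2,W_3),\\ F_7&=-s_2^2+s_1s_3+(L_{123}p_2+L_{124}p_4)s_1-(L_{125}p_2+L_{126}p_4)s_2\\&\quad+L_{123}\lambda(p_2^2,2p_2p_4,p_4^2)-L_{124}\mu(p_2^2,2p_2p_4,p_4^2)\\&\quad-L_{125}\lambda(p_1p_2,p_2p_3+p_1p_4,p_3p_4)+L_{126}\mu(p_1p_2,p_2p_3+p_1p_4,p_3p_4)\\&\quad+\kappa_1(-p_1^2+2up_2+t_1p_2^2)+\kappa_2(-p_1p_3+up_4+vp_2+t_1p_2p_4)+\kappa_3(-p_3^2+2vp_4+t_1p_4^2),\\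 F_8&=s_2s_3+t_1s_1s_2-t_2s_1^2+s_1(L_{123}p_1+L_{124}p_3)-s_2(L_{125}p_1+L_{126}p_3)\\&\quad+L_{123}\lambda(p_1p_2,p_1p_4+p_2p_3,p_3p_4)-L_{124}\mu(p_1p_2,p_1p_4+p_2p_3,p_3p_4)\\&\quad-L_{125}\lambda(p_1^2,2p_1p_3,p_3^2)+L_{126}\mu(p_1^2,2p_1p_3,p_3^2)\\&\quad+\kappa_1(2up_1+2t_1p_1p_2-t_2p_2^2)+\kappa_2(vp_1+up_3+t_1(p_1p_4+p_2p_3)-t_2p_2p_4)+\kappa_3(2vp_3+2t_1p_3p_4-t_2p_4^2),\\ F_9&=t_1s_2^2+s_3^2-t_2s_1s_2+s_1(L_{123}u+L_{124}v)-s_2(L_{125}u+L_{126}v)+(L_{124}L_{125}-L_{123}L_{126})\Delta\\&\quad-L_{123}\lambda(p_1^2+t_1p_2^2,\,2p_1p_3+2t_1p_2p_4,\,p_3^2+t_1p_4^2)+L_{124}\mu(p_1^2+t_1p_2^2,\,2p_1p_3+2t_1p_2p_4,\,p_3^2+t_1p_4^2)\\&\quad+t_2L_{125}\lambda(p_2^2,2p_2p_4,p_4^2)-t_2L_{126}\mu(p_2^2,2p_2p_4,p_4^2)\\&\quad+\kappa_1(u^2+2t_2p_1p_2)+\kappa_2(uv+t_2(p_2p_3+p_1p_4))+\kappa_3(v^2+2t_2p_3p_4). \end{align*} $\mathbb{A}(L)$ is the affine space with coordinates $L_{123},L_{124},L_{125},L_{126},L_{135},L_{136},L_{245},L_{246}$,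 and $\mathbb{A}_{\Pi}^{10}$ is the affine space with coordinates $t_1,t_2$ and these eight $L$'s. All of $F_1,\dots,F_9$ are homogeneous of degree two in $p_1,p_2,p_3,p_4,u,v,s_1,s_2,s_3$ when the coordinates of $\mathbb{A}_{\Pi}^{10}$ are regarded as constants; $\hat{\Pi}\subset\mathbb{P}(p_1,p_2,p_3,p_4,u,v,s_1,s_2,s_3)\times\mathbb{A}_{\Pi}^{10}=\mathbb{P}^8\times\mathbb{A}_{\Pi}^{10}$ is the subvariety they define. Let $\mathbb{A}(A,B)$ be the affine plane with coordinates $A,B$, $U_{AB}=\{(A-B)(2A+B)(A+2B)\neq0\}\subset\mathbb{A}(A,B)$, and let $b\colon\mathbb{A}(A,B)\times\mathbb{A}(L)\to\mathbb{A}_{\Pi}^{10}$ be the morphism given by $t_1=-A^2-AB-B^2$, $t_2=-AB(A+B)$ and the identity on the $L$'s. The image of $U_{AB}\times\mathbb{A}(L)$ under $b$ is $\{4t_1^3+27t_2^2\neq0\}\times\mathbb{A}(L)$. Let $\mathbb{A}(P)$ be the affine space with coordinates $p_{ijk}$ ($1\le i,j,k\le2$), and let $\mathcal{H}$ be the Cayley hyperdeterminant of $(p_{ijk})$: \begin{align*} \mathcal{H}=&\,p_{111}^2p_{222}^2+p_{112}^2p_{221}^2+p_{121}^2p_{212}^2+p_{122}^2p_{211}^2-2p_{111}p_{122}p_{211}p_{222}-2p_{111}p_{121}p_{212}p_{222}\\&-2p_{111}p_{112}p_{221}p_{222}-2p_{121}p_{122}p_{211}p_{212}-2p_{112}p_{122}p_{211}p_{221}-2p_{112}p_{121}p_{212}p_{221}\\&+4p_{111}p_{122}p_{212}p_{221}+4p_{112}p_{121}p_{211}p_{222}.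 \end{align*} There is an isomorphism $U_{AB}\times\mathbb{A}(L)\to U_{AB}\times\mathbb{A}(P)$ (identity on $U_{AB}$) given by \begin{align*} p_{111}&=-3L_{246},\quad p_{222}=3L_{135},\\ p_{112}&=3L_{245}+\tfrac{3(L_{124}+(A+B)L_{126})}{(2A+B)(A+2B)},\quad p_{121}=3L_{245}+\tfrac{3(-L_{124}+BL_{126})}{(A-B)(A+2B)},\\ p_{211}&=3L_{245}+\tfrac{3(L_{124}-AL_{126})}{(A-B)(2A+B)},\quad p_{122}=-3L_{136}+\tfrac{3(L_{123}-AL_{125})}{(A-B)(2A+B)},\\ p_{212}&=-3L_{136}+\tfrac{3(-L_{123}+BL_{125})}{(A-B)(A+2B)},\quad p_{221}=-3L_{136}+\tfrac{3(L_{123}+(A+B)L_{125})}{(2A+B)(A+2B)}. \end{align*} $\{\mathcal{H}'=0\}$ denotes the image under $b$ of the pull-back to $U_{AB}\times\mathbb{A}(L)$, by this isomorphism, of $U_{AB}\times\{\mathcal{H}=0\}$. $\mathbb{P}^{2,2}:=\{(\mathsf{S},\bm{\sigma})\mid\mathsf{S}^{\dagger}=O,\ \mathsf{S}\bm{\sigma}=\bm{0}\}\subset\mathbb{P}(\mathsf{S},\bm{\sigma})=\mathbb{P}^8$, where $\mathsf{S}=(s_{ij})$ is a symmetric $3\times3$ matrix of coordinates, $\bm{\sigma}$ is a column vector of three coordinates, and $\mathsf{S}^{\dagger}$ is the adjoint (adjugate) matrix of $\mathsf{S}$. *)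

(* Defs.v *)
From HB Require Import structures.
From mathcomp Require Import all_boot all_order all_algebra.
From mathcomp Require Import all_classical reals.
From mathcomp Require Export complex.
From mathcomp Require Import ring.
Set Implicit Arguments.
Unset Strict Implicit.
Unset Printing Implicit Defensive.
Import GRing.Theory.
Local Open Scope classical_set_scope.
Local Open Scope ring_scope.

Lemma sval_inj (T : Type) (P : T -> Prop) (x y : {x : T | P x}) :
  sval x = sval y -> x = y.
Proof.
by case: x y => [x Px] [y Py] /= xy; subst y; congr exist; exact: Prop_irrelevance.
Qed.

(* Schemes over k are represented by their functors of points
   X(S) = Hom_k(Spec S, X) on commutative k-algebras S.  By Yoneda, a morphism
   of k-schemes is the same thing as a natural transformation between these
   functors, and an isomorphism is a bijective one.  comAlgType excludes the
   zero algebra, on which every scheme has exactly one point.  The laws are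
   stated up to pointwise equality because two lrmorphisms with the same
   underlying function need not be syntactically equal. *)
Record kfunctor (k : comNzRingType) := Functor {
  pts :> comAlgType k -> Type;
  fmap : forall S S' : comAlgType k, {lrmorphism S -> S'} -> pts S -> pts S';
  fmap_id : forall (S : comAlgType k) (f : {lrmorphism S -> S}) (x : pts S),
    f =1 id -> fmap f x = x;
  fmap_comp : forall (S S' S'' : comAlgType k) (f : {lrmorphism S -> S'})
    (g : {lrmorphism S' -> S''}) (h : {lrmorphism S -> S''}) (x : pts S),
    h =1 g \o f -> fmap h x = fmap g (fmap f x)
}.

Record morphism (k : comNzRingType) (X Y : kfunctor k) := Morphism {
  app :> forall S : comAlgType k, X S -> Y S;
  app_natural : forall (S S' : comAlgType k) (f : {lrmorphism S -> S'}) (x : X S),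
    app (fmap f x) = fmap f (app x)
}.

(* The inverse of a bijective natural transformation is natural. *)
Definition isomorphic (k : comNzRingType) (X Y : kfunctor k) : Prop :=
  exists eta : morphism X Y, forall S : comAlgType k, bijective (@app k X Y eta S).

Section Constructions.
Variable k : comNzRingType.

Section Product.
Variables X Y : kfunctor k.

Definition prod_fmap (S S' : comAlgType k) (f : {lrmorphism S -> S'})
  (x : X S * Y S) : X S' * Y S' := (fmap f x.1, fmap f x.2).

Lemma prod_fmap_id (S : comAlgType k) (f : {lrmorphism S -> S}) x :
  f =1 id -> prod_fmap f x = x.
Proof. by case: x => x y fE; rewrite /prod_fmap !fmap_id. Qed.

Lemma prod_fmap_comp (S S' S'' : comAlgType k) (f : {lrmorphism S -> S'})
  (g : {lrmorphism S' -> S''}) (h : {lrmorphism S -> S''}) x :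
  h =1 g \o f -> prod_fmap h x = prod_fmap g (prod_fmap f x).
Proof. by move=> hE; rewrite /prod_fmap /= -!(fmap_comp _ hE). Qed.

Definition prodF : kfunctor k := Functor prod_fmap_id prod_fmap_comp.

Definition sndF : morphism prodF Y :=
  @Morphism k prodF Y (fun S x => x.2) (fun S S' f x => erefl).

End Product.

Section Subfunctor.
Variables (X : kfunctor k) (P : forall S : comAlgType k, set (X S)).
Hypothesis P_fmap : forall (S S' : comAlgType k) (f : {lrmorphism S -> S'}) (x : X S),
  P x -> P (fmap f x).

Definition sub_fmap (S S' : comAlgType k) (f : {lrmorphism S -> S'})
    (x : {x : X S | P x}) : {x : X S' | P x} :=
  exist _ (fmap f (sval x)) (P_fmap f (svalP x)).

Lemma sub_fmap_id (S : comAlgType k) (f : {lrmorphism S -> S}) x :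
  f =1 id -> sub_fmap f x = x.
Proof. by move=> fE; apply: sval_inj; exact: fmap_id. Qed.

Lemma sub_fmap_comp (S S' S'' : comAlgType k) (f : {lrmorphism S -> S'})
  (g : {lrmorphism S' -> S''}) (h : {lrmorphism S -> S''}) x :
  h =1 g \o f -> sub_fmap h x = sub_fmap g (sub_fmap f x).
Proof. by move=> hE; apply: sval_inj; exact: fmap_comp. Qed.

Definition subF : kfunctor k := Functor sub_fmap_id sub_fmap_comp.

Definition inclF : morphism subF X :=
  @Morphism k subF X (fun S x => sval x) (fun S S' f x => erefl).

End Subfunctor.

Definition compM (X Y Z : kfunctor k) (g : morphism Y Z) (f : morphism X Y) :
  morphism X Z.
Proof.
by exists (fun S x => g S (f S x)) => S S' h x; rewrite !app_natural.
Defined.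

(* The structure morphism k -> S, k being the initial k-algebra k^o. *)
Definition unit_fun (S : comAlgType k) (c : k^o) : S := (c : k)%:A.

Section UnitMorphism.
Variable S : comAlgType k.

Lemma unit_fun_linear : linear (@unit_fun S).
Proof. by move=> c x y; rewrite /unit_fun scalerDl scalerA. Qed.

Lemma unit_fun_monoid : monoid_morphism (@unit_fun S).
Proof.
split=> [|x y]; first exact: scale1r.
by rewrite /unit_fun -scalerAl mul1r scalerA.
Qed.

HB.instance Definition _ :=
  GRing.isLinear.Build k k^o S *:%R (@unit_fun S) unit_fun_linear.
HB.instance Definition _ :=
  GRing.isMonoidMorphism.Build k^o S (@unit_fun S) unit_fun_monoid.

Definition unit_alg : {lrmorphism k^o -> S} := @unit_fun S.

End UnitMorphism.

Lemma fibre_fmap (X Y : kfunctor k) (rho : morphism X Y) (a : Y k^o)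
    (S S' : comAlgType k) (f : {lrmorphism S -> S'}) (x : X S) :
  rho S x = fmap (unit_alg S) a ->
  rho S' (fmap f x) = fmap (unit_alg S') a.
Proof.
move=> xE; rewrite app_natural xE; apply/esym/fmap_comp => c /=.
by rewrite linearZ rmorph1.
Qed.

Definition fibre (X Y : kfunctor k) (rho : morphism X Y) (a : Y k^o) : kfunctor k :=
  subF (P := fun S x => rho S x = fmap (unit_alg S) a) (@fibre_fmap X Y rho a).

End Constructions.

(* Projective space.  An S-point of P^n is a line subbundle of the trivial
   bundle, i.e. a submodule L of S^(n+1) which, on each member D(f_i) of a
   finite cover of Spec S by principal open sets, is free on one vector l_i
   whose coordinates generate the unit ideal. *)
Section Lines.
Variables (S : comNzRingType) (n : nat).

Definition is_submod (L : set 'rV[S]_n) : Prop :=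
  L 0 /\ forall (c : S) (x y : 'rV[S]_n), L x -> L y -> L (c *: x + y).

Definition is_line (L : set 'rV[S]_n) : Prop :=
  is_submod L /\
  exists (m : nat) (f : 'I_m -> S) (l : 'I_m -> 'rV[S]_n),
    (exists c : 'I_m -> S, \sum_(i < m) c i * f i = 1) /\
    forall i : 'I_m,
      [/\ L (l i),
          exists d : 'I_n -> S, \sum_(j < n) d j * l i 0 j = f i
        & forall x, L x -> exists c : S, f i *: x = c *: l i].

Definition submod_span (G : set 'rV[S]_n) : set 'rV[S]_n := smallest is_submod G.

Lemma submod_span_submod (G : set 'rV[S]_n) : is_submod (submod_span G).
Proof.
split=> [M [[M0 _] _]|c x y Lx Ly M MG]; first exact: M0.
by apply: MG.1.2; [exact: Lx | exact: Ly].
Qed.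

Lemma submod_span_ind (G P : set 'rV[S]_n) : is_submod P -> G `<=` P -> submod_span G `<=` P.
Proof. by move=> subP GP; apply: smallest_sub. Qed.

End Lines.

Section BaseChange.
Variables (S S' : comNzRingType) (f : {rmorphism S -> S'}) (n : nat).

(* As L is locally a direct summand, L (x)_S S' is the span of its image. *)
Definition line_map (L : set 'rV[S]_n) : set 'rV[S']_n := submod_span (map_mx f @` L).

Lemma line_map_loc (L : set 'rV[S]_n) (r : S) (l : 'rV[S]_n) :
  (forall x, L x -> exists c : S, r *: x = c *: l) ->
  forall y, line_map L y -> exists c : S', f r *: y = c *: map_mx f l.
Proof.
move=> Ll; apply: submod_span_ind; first split.
- by exists 0; rewrite scaler0 scale0r.
- move=> c x y [cx xE] [cy yE]; exists (c * cx + cy).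
  by rewrite scalerDr scalerA mulrC -scalerA xE yE scalerDl scalerA.
- move=> _ [x Lx <-]; have [c cE] := Ll x Lx.
  by exists (f c); rewrite -!map_mxZ cE.
Qed.

Lemma line_map_line (L : set 'rV[S]_n) : is_line L -> is_line (line_map L).
Proof.
move=> [_ [m [g [l [[c cE] lP]]]]]; split; first exact: submod_span_submod.
exists m, (f \o g), (fun i => map_mx f (l i)); split.
  exists (f \o c); rewrite -(rmorph1 f) -cE rmorph_sum.
  by apply: eq_bigr => i _; rewrite rmorphM.
move=> i; have [Ll [d dE] lx] := lP i; split.
- by apply: sub_gen_smallest; exists (l i).
- exists (f \o d); rewrite /= -dE rmorph_sum.
  by apply: eq_bigr => j _; rewrite rmorphM mxE.
- exact: line_map_loc.
Qed.

(* Quadratic equations that vanish on a line vanish on its base change. *)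
Lemma line_map_vanish p q (Q : 'rV[S']_n -> 'M[S']_(p, q)) (L : set 'rV[S]_n) :
  is_line L ->
  (forall c z, Q (c *: z) = c ^+ 2 *: Q z) ->
  (forall z, L z -> Q (map_mx f z) = 0) ->
  forall y, line_map L y -> Q y = 0.
Proof.
move=> [_ [m [g [l [[c cE] lP]]]]] QZ QL y Ly.
have g2Q i : f (g i) ^+ 2 *: Q y = 0.
  have [Ll _ lx] := lP i; have [d dE] := line_map_loc lx Ly.
  by rewrite -QZ dE QZ QL // scaler0.
suff I N (r : seq 'I_m) : (size r <= N)%N ->
    (\sum_(i <- r) f (c i * g i)) ^+ N.+1 *: Q y = 0.
  have := I _ (index_enum 'I_m) (leqnn _).
  by rewrite -rmorph_sum cE rmorph1 expr1n scale1r.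
elim: N r => [|N IH] [|i r] //= sr; rewrite ?big_nil ?expr0n ?scale0r //.
rewrite big_cons; set a := f _; set b := \sum_(j <- r) _.
have a2 : a ^+ 2 *: Q y = 0.
  by rewrite /a rmorphM exprMn -scalerA g2Q scaler0.
rewrite exprDn scaler_suml big1 // => j _.
rewrite -scalerMnl; have [jN|Nj] := leqP j N.
  have -> : (N.+2 - j = (N - j) + 2)%N by rewrite addn2 !subSn // leqW.
  by rewrite exprD mulrAC -scalerA a2 scaler0 mul0rn.
by rewrite -(subnK Nj) exprD mulrA -scalerA IH // scaler0 mul0rn.
Qed.

End BaseChange.

Lemma line_map_id (S : comNzRingType) (f : {rmorphism S -> S}) n (L : set 'rV[S]_n) :
  is_line L -> f =1 id -> line_map f L = L.
Proof.
move=> [subL _] fE; have mE (x : 'rV[S]_n) : map_mx f x = x.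
  by apply/matrixP => i j; rewrite mxE fE.
apply/seteqP; split => [|x Lx].
  by apply: submod_span_ind => // _ [x Lx <-]; rewrite mE.
by apply: sub_gen_smallest; exists x.
Qed.

Lemma line_map_comp (S S' S'' : comNzRingType) (f : {rmorphism S -> S'})
    (g : {rmorphism S' -> S''}) (h : {rmorphism S -> S''}) n (L : set 'rV[S]_n) :
  h =1 g \o f -> line_map h L = line_map g (line_map f L).
Proof.
move=> hE; have mE (x : 'rV[S]_n) : map_mx h x = map_mx g (map_mx f x).
  by apply/matrixP => i j; rewrite !mxE hE.
apply/seteqP; split; apply: submod_span_ind; try exact: submod_span_submod.
  move=> _ [x Lx <-]; rewrite mE; apply: sub_gen_smallest.
  by exists (map_mx f x) => //; apply: sub_gen_smallest; exists x.
move=> _ [y Ly <-]; move: y Ly; apply: submod_span_ind; first split => /=.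
- by rewrite map_mx0; exact: (submod_span_submod _).1.
- move=> c x y Lx Ly; rewrite map_mxD map_mxZ.
  exact: (submod_span_submod _).2.
- by move=> _ [x Lx <-] /=; apply: sub_gen_smallest; exists x; rewrite ?mE.
Qed.

Section ProjectiveSpace.
Variables (k : comNzRingType) (n : nat).

Definition proj_fmap (S S' : comAlgType k) (f : {lrmorphism S -> S'})
    (L : {L : set 'rV[S]_n.+1 | is_line L}) : {L : set 'rV[S']_n.+1 | is_line L} :=
  exist _ (line_map f (sval L)) (line_map_line f (svalP L)).

Lemma proj_fmap_id (S : comAlgType k) (f : {lrmorphism S -> S}) L :
  f =1 id -> proj_fmap f L = L.
Proof. by move=> fE; apply: sval_inj; exact: line_map_id (svalP L) fE. Qed.

Lemma proj_fmap_comp (S S' S'' : comAlgType k) (f : {lrmorphism S -> S'})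
  (g : {lrmorphism S' -> S''}) (h : {lrmorphism S -> S''}) L :
  h =1 g \o f -> proj_fmap h L = proj_fmap g (proj_fmap f L).
Proof. by move=> hE; apply: sval_inj; exact: line_map_comp. Qed.

Definition Proj : kfunctor k := Functor proj_fmap_id proj_fmap_comp.

End ProjectiveSpace.

(* Points of A(L), of the base A_Pi^10, and of A(P). *)
Record ptL (S : Type) := PtL {
  L123 : S; L124 : S; L125 : S; L126 : S; L135 : S; L136 : S; L245 : S; L246 : S
}.
Record ptPi (S : Type) := PtPi { t1 : S; t2 : S; ptPi_L :> ptL S }.
Record ptP (S : Type) := PtP {
  p111 : S; p112 : S; p121 : S; p122 : S; p211 : S; p212 : S; p221 : S; p222 : S
}.

Definition ptPi_map (S S' : Type) (f : S -> S') (a : ptPi S) : ptPi S' :=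
  PtPi (f (t1 a)) (f (t2 a))
    (PtL (f (L123 a)) (f (L124 a)) (f (L125 a)) (f (L126 a))
         (f (L135 a)) (f (L136 a)) (f (L245 a)) (f (L246 a))).

Section Base.
Variable k : comNzRingType.

Lemma ptPi_map_id (S : comAlgType k) (f : {lrmorphism S -> S}) (a : ptPi S) :
  f =1 id -> ptPi_map f a = a.
Proof. by move=> fE; case: a => ? ? [] *; rewrite /ptPi_map /= !fE. Qed.

Lemma ptPi_map_comp (S S' S'' : comAlgType k) (f : {lrmorphism S -> S'})
  (g : {lrmorphism S' -> S''}) (h : {lrmorphism S -> S''}) (a : ptPi S) :
  h =1 g \o f -> ptPi_map h a = ptPi_map g (ptPi_map f a).
Proof. by move=> hE; rewrite /ptPi_map /= !hE. Qed.

Definition APi10 : kfunctor k :=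
  @Functor k (fun S => ptPi S) (fun S S' f => ptPi_map f)
    ptPi_map_id ptPi_map_comp.

End Base.

Section Equations.
Variables (S : comNzRingType) (z : 'rV[S]_9) (a : ptPi S).

Local Notation p1 := (z 0 0).
Local Notation p2 := (z 0 1).
Local Notation p3 := (z 0 2).
Local Notation p4 := (z 0 3).
Local Notation u := (z 0 4).
Local Notation v := (z 0 5).
Local Notation s1 := (z 0 6).
Local Notation s2 := (z 0 7).
Local Notation s3 := (z 0 8).
Local Notation t1 := (t1 a).
Local Notation t2 := (t2 a).
Local Notation L123 := (L123 a).
Local Notation L124 := (L124 a).
Local Notation L125 := (L125 a).
Local Notation L126 := (L126 a).
Local Notation L135 := (L135 a).
Local Notation L136 := (L136 a).
Local Notation L245 := (L245 a).
Local Notation L246 := (L246 a).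

Definition Delta : S := p1 * p4 - p2 * p3.
Definition lam (X Y Z : S) : S := L136 * X + L245 * Y + L246 * Z.
Definition mu (X Y Z : S) : S := L135 * X + L136 * Y + L245 * Z.

Definition U1 : S := p1 ^+ 2 + t1 * p2 ^+ 2 + p2 * u.
Definition U2 : S := 2 * p1 * p3 + 2 * t1 * p2 * p4 + p4 * u + p2 * v.
Definition U3 : S := p3 ^+ 2 + t1 * p4 ^+ 2 + p4 * v.
Definition I1 : S := t2 * p2 ^+ 2 + p1 * u.
Definition I2 : S := 2 * t2 * p2 * p4 + p3 * u + p1 * v.
Definition I3 : S := t2 * p4 ^+ 2 + p3 * v.
Definition W1 : S := t1 * p2 * u - t2 * p1 * p2 + u ^+ 2.
Definition W2 : S := t1 * (p4 * u + p2 * v) - t2 * (p2 * p3 + p1 * p4) + 2 * u * v.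
Definition W3 : S := t1 * p4 * v - t2 * p3 * p4 + v ^+ 2.
Definition kappa1 : S := L135 * L245 - L136 ^+ 2.
Definition kappa2 : S := L135 * L246 - L136 * L245.
Definition kappa3 : S := L136 * L246 - L245 ^+ 2.

Definition F1 : S :=
  u * s1 - p1 * s2 - p2 * s3 - L126 * Delta - lam U1 U2 U3.

Definition F2 : S :=
  v * s1 - p3 * s2 - p4 * s3 + L125 * Delta + mu U1 U2 U3.

Definition F3 : S :=
  - t2 * p2 * s1 + (u + t1 * p2) * s2 - p1 * s3 - L124 * Delta - lam I1 I2 I3.

Definition F4 : S :=
  - t2 * p4 * s1 + (v + t1 * p4) * s2 - p3 * s3 + L123 * Delta + mu I1 I2 I3.

Definition F5 : S :=
  - t2 * p1 * s1 + (t1 * p1 - t2 * p2) * s2 + (u + t1 * p2) * s3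
  + L123 * U1 + L124 * (p1 * p3 + t1 * p2 * p4 + p2 * v)
  - L125 * I1 - L126 * (t2 * p2 * p4 + p1 * v) - lam W1 W2 W3.

Definition F6 : S :=
  - t2 * p3 * s1 + (t1 * p3 - t2 * p4) * s2 + (v + t1 * p4) * s3
  + L123 * (p1 * p3 + t1 * p2 * p4 + p4 * u) + L124 * U3
  - L125 * (t2 * p2 * p4 + p3 * u) - L126 * I3 + mu W1 W2 W3.

Definition F7 : S :=
  - s2 ^+ 2 + s1 * s3 + (L123 * p2 + L124 * p4) * s1
  - (L125 * p2 + L126 * p4) * s2
  + L123 * lam (p2 ^+ 2) (2 * p2 * p4) (p4 ^+ 2)
  - L124 * mu (p2 ^+ 2) (2 * p2 * p4) (p4 ^+ 2)
  - L125 * lam (p1 * p2) (p2 * p3 + p1 * p4) (p3 * p4)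
  + L126 * mu (p1 * p2) (p2 * p3 + p1 * p4) (p3 * p4)
  + kappa1 * (- p1 ^+ 2 + 2 * u * p2 + t1 * p2 ^+ 2)
  + kappa2 * (- (p1 * p3) + u * p4 + v * p2 + t1 * p2 * p4)
  + kappa3 * (- p3 ^+ 2 + 2 * v * p4 + t1 * p4 ^+ 2).

Definition F8 : S :=
  s2 * s3 + t1 * s1 * s2 - t2 * s1 ^+ 2 + s1 * (L123 * p1 + L124 * p3)
  - s2 * (L125 * p1 + L126 * p3)
  + L123 * lam (p1 * p2) (p1 * p4 + p2 * p3) (p3 * p4)
  - L124 * mu (p1 * p2) (p1 * p4 + p2 * p3) (p3 * p4)
  - L125 * lam (p1 ^+ 2) (2 * p1 * p3) (p3 ^+ 2)
  + L126 * mu (p1 ^+ 2) (2 * p1 * p3) (p3 ^+ 2)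
  + kappa1 * (2 * u * p1 + 2 * t1 * p1 * p2 - t2 * p2 ^+ 2)
  + kappa2 * (v * p1 + u * p3 + t1 * (p1 * p4 + p2 * p3) - t2 * p2 * p4)
  + kappa3 * (2 * v * p3 + 2 * t1 * p3 * p4 - t2 * p4 ^+ 2).

Definition F9 : S :=
  t1 * s2 ^+ 2 + s3 ^+ 2 - t2 * s1 * s2 + s1 * (L123 * u + L124 * v)
  - s2 * (L125 * u + L126 * v) + (L124 * L125 - L123 * L126) * Delta
  - L123 * lam (p1 ^+ 2 + t1 * p2 ^+ 2) (2 * p1 * p3 + 2 * t1 * p2 * p4)
               (p3 ^+ 2 + t1 * p4 ^+ 2)
  + L124 * mu (p1 ^+ 2 + t1 * p2 ^+ 2) (2 * p1 * p3 + 2 * t1 * p2 * p4)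
              (p3 ^+ 2 + t1 * p4 ^+ 2)
  + t2 * L125 * lam (p2 ^+ 2) (2 * p2 * p4) (p4 ^+ 2)
  - t2 * L126 * mu (p2 ^+ 2) (2 * p2 * p4) (p4 ^+ 2)
  + kappa1 * (u ^+ 2 + 2 * t2 * p1 * p2)
  + kappa2 * (u * v + t2 * (p2 * p3 + p1 * p4))
  + kappa3 * (v ^+ 2 + 2 * t2 * p3 * p4).

Definition eqPi : 'rV[S]_9 :=
  \row_(i < 9) [:: F1; F2; F3; F4; F5; F6; F7; F8; F9]`_i.

End Equations.

Lemma eqPiZ (S : comNzRingType) (c : S) (z : 'rV[S]_9) (a : ptPi S) :
  eqPi (c *: z) a = c ^+ 2 *: eqPi z a.
Proof.
apply/rowP => i; rewrite !mxE.
have E1 : F1 (c *: z) a = c ^+ 2 * F1 z a.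
  by rewrite /F1 /lam /U1 /U2 /U3 /Delta !mxE; ring.
have E2 : F2 (c *: z) a = c ^+ 2 * F2 z a.
  by rewrite /F2 /mu /U1 /U2 /U3 /Delta !mxE; ring.
have E3 : F3 (c *: z) a = c ^+ 2 * F3 z a.
  by rewrite /F3 /lam /I1 /I2 /I3 /Delta !mxE; ring.
have E4 : F4 (c *: z) a = c ^+ 2 * F4 z a.
  by rewrite /F4 /mu /I1 /I2 /I3 /Delta !mxE; ring.
have E5 : F5 (c *: z) a = c ^+ 2 * F5 z a.
  by rewrite /F5 /lam /U1 /I1 /W1 /W2 /W3 !mxE; ring.
have E6 : F6 (c *: z) a = c ^+ 2 * F6 z a.
  by rewrite /F6 /mu /U3 /I3 /W1 /W2 /W3 !mxE; ring.
have E7 : F7 (c *: z) a = c ^+ 2 * F7 z a.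
  by rewrite /F7 /lam /mu !mxE; ring.
have E8 : F8 (c *: z) a = c ^+ 2 * F8 z a.
  by rewrite /F8 /lam /mu !mxE; ring.
have E9 : F9 (c *: z) a = c ^+ 2 * F9 z a.
  by rewrite /F9 /lam /mu /Delta !mxE; ring.
by case: i => [[|[|[|[|[|[|[|[|[|i]]]]]]]]] Hi] //=.
Qed.

Lemma eqPi_map (S S' : comNzRingType) (f : {rmorphism S -> S'}) (z : 'rV[S]_9)
  (a : ptPi S) : eqPi (map_mx f z) (ptPi_map f a) = map_mx f (eqPi z a).
Proof.
apply/rowP => i; rewrite !mxE.
have E1 : F1 (map_mx f z) (ptPi_map f a) = f (F1 z a).
  by rewrite /F1 /lam /U1 /U2 /U3 /Delta !mxE /=; ring.
have E2 : F2 (map_mx f z) (ptPi_map f a) = f (F2 z a).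
  by rewrite /F2 /mu /U1 /U2 /U3 /Delta !mxE /=; ring.
have E3 : F3 (map_mx f z) (ptPi_map f a) = f (F3 z a).
  by rewrite /F3 /lam /I1 /I2 /I3 /Delta !mxE /=; ring.
have E4 : F4 (map_mx f z) (ptPi_map f a) = f (F4 z a).
  by rewrite /F4 /mu /I1 /I2 /I3 /Delta !mxE /=; ring.
have E5 : F5 (map_mx f z) (ptPi_map f a) = f (F5 z a).
  by rewrite /F5 /lam /U1 /I1 /W1 /W2 /W3 !mxE /=; ring.
have E6 : F6 (map_mx f z) (ptPi_map f a) = f (F6 z a).
  by rewrite /F6 /mu /U3 /I3 /W1 /W2 /W3 !mxE /=; ring.
have E7 : F7 (map_mx f z) (ptPi_map f a) = f (F7 z a).
  by rewrite /F7 /lam /mu /kappa1 /kappa2 /kappa3 !mxE /=; ring.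
have E8 : F8 (map_mx f z) (ptPi_map f a) = f (F8 z a).
  by rewrite /F8 /lam /mu /kappa1 /kappa2 /kappa3 !mxE /=; ring.
have E9 : F9 (map_mx f z) (ptPi_map f a) = f (F9 z a).
  by rewrite /F9 /lam /mu /kappa1 /kappa2 /kappa3 /Delta !mxE /=; ring.
by case: i => [[|[|[|[|[|[|[|[|[|i]]]]]]]]] Hi] //=.
Qed.

Section PiHat.
Variable k : comNzRingType.

(* A form vanishes on a line subbundle L iff it vanishes on all vectors of L,
   since those generate L locally. *)
Definition on_PiHat (S : comAlgType k) (x : prodF (Proj k 8) (APi10 k) S) : Prop :=
  forall z, sval x.1 z -> eqPi z x.2 = 0.

Lemma on_PiHat_fmap (S S' : comAlgType k) (f : {lrmorphism S -> S'})
  (x : prodF (Proj k 8) (APi10 k) S) : on_PiHat x -> on_PiHat (fmap f x).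
Proof.
move=> xP; apply: (line_map_vanish (svalP x.1)) => [c z|z zx].
  exact: eqPiZ.
by rewrite [(fmap f x).2]/(ptPi_map f x.2) eqPi_map xP // map_mx0.
Qed.

Definition PiHat : kfunctor k := subF on_PiHat_fmap.

Definition rhoPi : morphism PiHat (APi10 k) :=
  compM (sndF (Proj k 8) (APi10 k)) (inclF on_PiHat_fmap).

End PiHat.

(* Homogeneous coordinates s11, s12, s13, s22, s23, s33, sigma1, sigma2, sigma3. *)
Definition symS (S : comNzRingType) (z : 'rV[S]_9) : 'M[S]_3 :=
  \matrix_(i < 3, j < 3)
    (nth [::] [:: [:: z 0 0; z 0 1; z 0 2];
                  [:: z 0 1; z 0 3; z 0 4];
                  [:: z 0 2; z 0 4; z 0 5]] i)`_j.
Definition sigma (S : comNzRingType) (z : 'rV[S]_9) : 'cV[S]_3 :=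
  \col_(i < 3) [:: z 0 6; z 0 7; z 0 8]`_i.

Lemma symSZ (S : comNzRingType) (c : S) (z : 'rV[S]_9) :
  symS (c *: z) = c *: symS z.
Proof.
by apply/matrixP; case=> [[|[|[|i]]] Hi] //; case=> [[|[|[|j]]] Hj] //;
  rewrite !mxE /= ?mxE.
Qed.

Lemma sigmaZ (S : comNzRingType) (c : S) (z : 'rV[S]_9) :
  sigma (c *: z) = c *: sigma z.
Proof. by apply/colP; case=> [[|[|[|i]]] Hi] //; rewrite !mxE /= ?mxE. Qed.

Lemma symS_map (S S' : comNzRingType) (f : {rmorphism S -> S'}) (z : 'rV[S]_9) :
  symS (map_mx f z) = map_mx f (symS z).
Proof.
by apply/matrixP; case=> [[|[|[|i]]] Hi] //; case=> [[|[|[|j]]] Hj] //;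
  rewrite !mxE /= ?mxE.
Qed.

Lemma sigma_map (S S' : comNzRingType) (f : {rmorphism S -> S'}) (z : 'rV[S]_9) :
  sigma (map_mx f z) = map_mx f (sigma z).
Proof. by apply/colP; case=> [[|[|[|i]]] Hi] //; rewrite !mxE /= ?mxE. Qed.

Section P22.
Variable k : comNzRingType.

Definition on_P22 (S : comAlgType k) (L : Proj k 8 S) : Prop :=
  forall z, sval L z -> \adj (symS z) = 0 /\ symS z *m sigma z = 0.

Lemma on_P22_fmap (S S' : comAlgType k) (f : {lrmorphism S -> S'}) (L : Proj k 8 S) :
  on_P22 L -> on_P22 (fmap f L).
Proof.
move=> LP y Ly; split.
  apply: (line_map_vanish (Q := fun z => \adj (symS z)) (svalP L) _ _ Ly) => [c z|z zL].
    by rewrite symSZ adjZ.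
  by rewrite symS_map -map_mx_adj (LP z zL).1 map_mx0.
apply: (line_map_vanish (Q := fun z => symS z *m sigma z) (svalP L) _ _ Ly) => [c z|z zL].
  by rewrite symSZ sigmaZ -scalemxAl -scalemxAr scalerA.
by rewrite symS_map sigma_map -map_mxM (LP z zL).2 map_mx0.
Qed.

Definition P22 : kfunctor k := subF on_P22_fmap.

End P22.

Section Hyperdeterminant.
Variable k : fieldType.

Definition in_UAB (A B : k) : Prop :=
  (A - B) * (2 * A + B) * (A + 2 * B) != 0.

Definition bmap (A B : k) (L : ptL k) : ptPi k :=
  PtPi (- A ^+ 2 - A * B - B ^+ 2) (- (A * B * (A + B))) L.

(* The isomorphism U_AB x A(L) -> U_AB x A(P), on second components. *)
Definition LtoP (A B : k) (L : ptL k) : ptP k := {|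
  p111 := - 3 * L246 L;
  p222 := 3 * L135 L;
  p112 := 3 * L245 L
    + 3 * (L124 L + (A + B) * L126 L) / ((2 * A + B) * (A + 2 * B));
  p121 := 3 * L245 L
    + 3 * (- L124 L + B * L126 L) / ((A - B) * (A + 2 * B));
  p211 := 3 * L245 L
    + 3 * (L124 L - A * L126 L) / ((A - B) * (2 * A + B));
  p122 := - 3 * L136 L
    + 3 * (L123 L - A * L125 L) / ((A - B) * (2 * A + B));
  p212 := - 3 * L136 L
    + 3 * (- L123 L + B * L125 L) / ((A - B) * (A + 2 * B));
  p221 := - 3 * L136 L
    + 3 * (L123 L + (A + B) * L125 L) / ((2 * A + B) * (A + 2 * B))
|}.

Definition hyperdet (p : ptP k) : k :=
  let: PtP p111 p112 p121 p122 p211 p212 p221 p222 := p in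
  p111 ^+ 2 * p222 ^+ 2 + p112 ^+ 2 * p221 ^+ 2
  + p121 ^+ 2 * p212 ^+ 2 + p122 ^+ 2 * p211 ^+ 2
  - 2 * p111 * p122 * p211 * p222 - 2 * p111 * p121 * p212 * p222
  - 2 * p111 * p112 * p221 * p222 - 2 * p121 * p122 * p211 * p212
  - 2 * p112 * p122 * p211 * p221 - 2 * p112 * p121 * p212 * p221
  + 4 * p111 * p122 * p212 * p221 + 4 * p112 * p121 * p211 * p222.

Definition Hprime : set (ptPi k) :=
  [set a | exists A B L, [/\ in_UAB A B, hyperdet (LtoP A B L) = 0 & bmap A B L = a]].

End Hyperdeterminant.

(* Main.v *)
Require Import Defs.
From mathcomp Require Import all_boot all_order all_algebra.
From mathcomp Require Import all_classical reals.
From mathcomp Require Import ring.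
Set Implicit Arguments.
Unset Strict Implicit.
Unset Printing Implicit Defensive.
Import GRing.Theory Num.Theory.
Local Open Scope classical_set_scope.
Local Open Scope ring_scope.
Local Open Scope complex_scope.

(* Let A, B, C be the roots of x^3 + t1 x - t2, so A + B + C = 0; they are
   distinct when 4 t1^3 + 27 t2^2 <> 0.  Evaluating the pencils of equations at
   the roots, i.e. forming (t1 + A^2) F1 + A F3 + F5, (t1 + A^2) F2 + A F4 + F6,
   F9 - A F8 - A^2 F7 and their analogues at B and C, and passing to the
   coordinates X_i = u - A p1 - A^2 p2, Y_i = v - A p3 - A^2 p4 and suitable
   u_i (i = 1, 2, 3 for the roots A, B, C), one obtains
     X_i u_i + dT/dx_i1 = Y_i u_i + dT/dx_i2 = 0,  u_j u_k + det T(x_i) = 0,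
   where x_i = (- Y_i, X_i) and T(x_1, x_2, x_3) is the trilinear form with
   coefficients p_ijk / 3.  If the hyperdeterminant is nonzero, T is a sum of two
   products of linear forms that are independent in each variable, and the nine
   equations become the 2 x 2 minors of a generic 3 x 3 matrix, i.e. the
   equations of the Segre embedding of P^2 x P^2.  If T = x_11 x_21 x_32 +
   x_11 x_22 x_31 + x_12 x_21 x_31, the hyperdeterminant vanishes and the
   equations are those of P^{2,2}. *)

(** * Isomorphism of functors of points *)

Section Isomorphisms.
Variable k : comNzRingType.

Lemma isomorphic_sym (X Y : kfunctor k) : isomorphic X Y -> isomorphic Y X.
Proof.
move=> [eta bij_eta].
have inv_ex S : {g : Y S -> X S | cancel (eta S) g /\ cancel g (eta S)}.
  by apply: cid; have [g] := bij_eta S; exists g.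
pose inv S := sval (inv_ex S).
have invP S : cancel (eta S) (inv S) /\ cancel (inv S) (eta S) := svalP (inv_ex S).
have inv_nat (S S' : comAlgType k) (f : {lrmorphism S -> S'}) (y : Y S) :
    inv S' (Defs.fmap f y) = Defs.fmap f (inv S y).
  by rewrite -{1}((invP S).2 y) -app_natural (invP S').1.
exists (Morphism inv_nat) => S.
by exists (eta S); [exact: (invP S).2 | exact: (invP S).1].
Qed.

Lemma isomorphic_trans (X Y Z : kfunctor k) :
  isomorphic X Y -> isomorphic Y Z -> isomorphic X Z.
Proof.
move=> [eta bij_eta] [theta bij_theta]; exists (compM theta eta) => S.
exact: bij_comp (bij_theta S) (bij_eta S).
Qed.

End Isomorphisms.

(** * Ideals, submodules and covers by principal open sets *)

Section Ideals.
Variable S : comNzRingType.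

Definition is_ideal (I : set S) : Prop :=
  I 0 /\ forall c x y, I x -> I y -> I (c * x + y).

Variable I : set S.
Hypothesis idI : is_ideal I.

Lemma idealMl c x : I x -> I (c * x).
Proof. by move=> Ix; rewrite -[c * x]addr0; apply: idI.2 => //; exact: idI.1. Qed.

Lemma ideal_sum (J : Type) (r : seq J) (P : pred J) (F : J -> S) :
  (forall j, P j -> I (F j)) -> I (\sum_(j <- r | P j) F j).
Proof.
move=> IF; apply: (big_ind I) => //; first exact: idI.1.
by move=> x y Ix Iy; rewrite -[x]mul1r; apply: idI.2.
Qed.

(** In each term of the binomial expansion either the exponent of [y] is at least [M] or that of [x]
    is at least [N]. *)
Lemma ideal_radicalD x y N M : I (x ^+ N) -> I (y ^+ M) -> I ((x + y) ^+ (N + M)).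
Proof.
move=> Ix Iy; rewrite exprDn; apply: ideal_sum => j _; rewrite -mulr_natl.
apply: idealMl; have [Mj|jM] := leqP M j.
  by rewrite -(subnK Mj) exprD mulrA; exact: idealMl.
by rewrite -addnBA ?(ltnW jM)// exprD -mulrA mulrC; exact: idealMl.
Qed.

(** The radical of [I] is closed under linear combinations, so it contains 1, and all powers of 1
    are 1. *)
Lemma ideal_cover_exp (J : finType) (c f : J -> S) :
  \sum_j c j * f j = 1 -> (forall j, exists N, I (f j ^+ N)) -> I 1.
Proof.
move=> cf1 If; have : exists N, I ((\sum_j c j * f j) ^+ N).
  apply: (big_ind (fun x => exists N, I (x ^+ N))).
  - by exists 1%N; rewrite expr1; exact: idI.1.
  - by move=> x y [N Ix] [M Iy]; exists (N + M)%N; exact: ideal_radicalD.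
  - by move=> j _; have [N IN] := If j; exists N; rewrite exprMn; exact: idealMl.
by rewrite cf1 => -[N]; rewrite expr1n.
Qed.

End Ideals.

Section Submodules.
Variables (S : comNzRingType) (n : nat) (L : set 'rV[S]_n).
Hypothesis subL : is_submod L.

Lemma submodZ c x : L x -> L (c *: x).
Proof. by move=> Lx; rewrite -[c *: x]addr0; apply: subL.2 => //; exact: subL.1. Qed.

Lemma submod_sum (J : Type) (r : seq J) (P : pred J) (F : J -> 'rV[S]_n) :
  (forall j, P j -> L (F j)) -> L (\sum_(j <- r | P j) F j).
Proof.
move=> LF; apply: (big_ind L) => //; first exact: subL.1.
by move=> x y Lx Ly; rewrite -[x]scale1r; apply: subL.2.
Qed.

(** This makes membership in a submodule local: [L x] follows once this ideal contains powers of the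
    functions of a cover. *)
Lemma colon_ideal x : is_ideal [set c | L (c *: x)].
Proof.
split=> [|c y z Ly Lz] /=; first by rewrite scale0r; exact: subL.1.
by rewrite scalerDl -scalerA; apply: subL.2.
Qed.

End Submodules.

Lemma submod_span_gen (S : comNzRingType) n (G : set 'rV[S]_n) x : G x -> submod_span G x.
Proof. exact: sub_gen_smallest. Qed.

Section LineCharts.
Variables (S : comNzRingType) (n : nat).

(* On D(g) the submodule is free on one vector with unimodular coordinates. *)
Definition line_chart (L : set 'rV[S]_n) (g : S) : Prop :=
  exists l : 'rV[S]_n,
    [/\ L l, exists d : 'I_n -> S, \sum_(j < n) d j * l 0 j = g
      & forall x, L x -> exists c : S, g *: x = c *: l].

Lemma line_cover_exp (L : set 'rV[S]_n) (I : set S) : is_line L -> is_ideal I ->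
  (forall g, line_chart L g -> exists N, I (g ^+ N)) -> I 1.
Proof.
move=> [_ [m [f [l [[c cf1] fP]]]]] idI If.
by apply: (ideal_cover_exp idI cf1) => i; apply: If; exists (l i); exact: fP.
Qed.

Lemma line_cover (L : set 'rV[S]_n) (I : set S) : is_line L -> is_ideal I ->
  (forall g, line_chart L g -> I g) -> I 1.
Proof.
by move=> lineL idI If; apply: (line_cover_exp lineL idI) => g /If; exists 1%N; rewrite expr1.
Qed.

(* That the charts cover Spec S is expressed by: an ideal containing all chart
   functions g contains 1. *)
Lemma is_line_cover (L : set 'rV[S]_n) : is_submod L ->
  (forall I : set S, is_ideal I -> (forall g, line_chart L g -> I g) -> I 1) ->
  is_line L.
Proof.
move=> subL cover; split=> //.
(* The ideal generated by the chart functions. A finite list expressing 1 in it is the cover that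
   [is_line] asks for. *)
pose I := [set a : S | exists s : seq (S * S),
  (forall p, p \in s -> line_chart L p.2) /\ \sum_(p <- s) p.1 * p.2 = a].
have [|g gL|s [sL s1]] := cover I.
- split=> [|c x y [s [sL sx]] [s' [s'L s'y]]].
    by exists [::]; rewrite big_nil; split.
  exists ([seq (c * p.1, p.2) | p <- s] ++ s'); split.
    by move=> p; rewrite mem_cat => /orP[/mapP[q qs ->]|]; [exact: sL qs | exact: s'L].
  rewrite big_cat big_map /= s'y -sx mulr_sumr.
  by congr (_ + _); apply: eq_bigr => p _; rewrite mulrA.
- exists [:: (1, g)]; rewrite big_seq1 mul1r; split=> // p.
  by rewrite inE => /eqP ->.
have /choice[l lP] (i : 'I_(size s)) : exists l : 'rV[S]_n,
    [/\ L l, exists d : 'I_n -> S, \sum_(j < n) d j * l 0 j = (nth 0 s i).2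
      & forall x, L x -> exists c : S, (nth 0 s i).2 *: x = c *: l].
  by apply: (sL (nth 0 s i)); exact: mem_nth.
exists (size s), (fun i => (nth 0 s i).2), l; split=> //.
by exists (fun i => (nth 0 s i).1); rewrite -s1 (big_nth 0) big_mkord.
Qed.

End LineCharts.

Lemma line_cover2 (S : comNzRingType) p q (L1 : set 'rV[S]_p) (L2 : set 'rV[S]_q)
    (I : set S) : is_line L1 -> is_line L2 -> is_ideal I ->
  (forall g1 g2, line_chart L1 g1 -> line_chart L2 g2 -> exists N, I ((g1 * g2) ^+ N)) ->
  I 1.
Proof.
move=> line1 line2 idI IL.
(* For fixed [g1] this is an ideal. It contains every chart function [g2] of [L2], hence 1, so a
   power of [g1] lies in [I]; the charts of [L1] then finish. *)
pose rad g1 := [set a | exists N, I ((g1 * a) ^+ N)].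
have rad_ideal g1 : is_ideal (rad g1).
  split=> [|a x y [N xN] [M yM]] /=.
    by exists 1%N; rewrite expr1 mulr0; exact: idI.1.
  exists (N + M)%N; rewrite mulrDr; apply: (ideal_radicalD idI) => //.
  by rewrite mulrCA exprMn; apply: idealMl.
apply: (line_cover_exp line1 idI) => g1 chart1.
rewrite -[g1]mulr1; apply: (line_cover line2 (rad_ideal g1)) => g2 chart2.
exact: IL.
Qed.

(** * Lines under linear changes of coordinates *)

Section LinearImage.
Variables (S : comNzRingType) (n : nat).

Definition lin_image (M : 'M[S]_n) (L : set 'rV[S]_n) : set 'rV[S]_n :=
  [set x *m M | x in L].

Lemma lin_image_submod (M : 'M[S]_n) (L : set 'rV[S]_n) :
  is_submod L -> is_submod (lin_image M L).
Proof.
move=> [L0 subL]; split; first by exists 0 => //; rewrite mul0mx.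
move=> c _ _ [x Lx <-] [y Ly <-]; exists (c *: x + y); first exact: subL.
by rewrite mulmxDl scalemxAl.
Qed.

Lemma lin_imageK (M N : 'M[S]_n) (L : set 'rV[S]_n) :
  M *m N = 1%:M -> lin_image N (lin_image M L) = L.
Proof.
move=> MN1; apply/seteqP; split => [_ [_ [x Lx <-] <-]|x Lx].
  by rewrite -mulmxA MN1 mulmx1.
by exists (x *m M); [exists x | rewrite -mulmxA MN1 mulmx1].
Qed.

Lemma lin_image_line (M N : 'M[S]_n) (L : set 'rV[S]_n) :
  M *m N = 1%:M -> is_line L -> is_line (lin_image M L).
Proof.
move=> MN1 [subL [m [f [l [cf1 fP]]]]]; split; first exact: lin_image_submod.
exists m, f, (fun i => l i *m M); split=> // i.
have [Ll [d dE] lx] := fP i; split; first by exists (l i).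
  (* The functional [d] is composed with the inverse matrix [N], so its value on [l i *m M] is that
     of [d] on [l i]. *)
  exists (fun j => \sum_h d h * N j h).
  under eq_bigr do rewrite mulr_suml.
  rewrite exchange_big /= -dE; apply: eq_bigr => h _.
  rewrite -[l i in RHS]mulmx1 -MN1 mulmxA mxE mulr_sumr.
  by apply: eq_bigr => j _; rewrite -mulrA [N j h * _]mulrC.
move=> _ [x Lx <-]; have [c cE] := lx x Lx.
by exists c; rewrite !scalemxAl cE.
Qed.

End LinearImage.

Lemma line_map_lin_image (S S' : comNzRingType) (f : {rmorphism S -> S'}) n
    (M : 'M[S]_n) (L : set 'rV[S]_n) :
  line_map f (lin_image M L) = lin_image (map_mx f M) (line_map f L).
Proof.
apply/seteqP; split.
  apply: submod_span_ind; first exact/lin_image_submod/submod_span_submod.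
  move=> _ [_ [x Lx <-] <-]; rewrite map_mxM; exists (map_mx f x) => //.
  by apply: submod_span_gen; exists x.
move=> _ [x Lx <-]; move: x Lx; apply: submod_span_ind; first split => /=.
- by rewrite mul0mx; exact: (submod_span_submod _).1.
- move=> c x y Lx Ly; rewrite mulmxDl -scalemxAl.
  exact: (submod_span_submod _).2.
- move=> _ [x Lx <-]; rewrite /= -map_mxM; apply: submod_span_gen.
  by exists (x *m M) => //; exists x.
Qed.

Section FibreCoordinates.
Variable k : fieldType.

Definition base_mx (S : comAlgType k) n (M : 'M[k]_n) : 'M[S]_n :=
  map_mx (unit_alg S) (M : 'M[k^o]_n).

Lemma base_mxM (S : comAlgType k) n (M N : 'M[k]_n) :
  base_mx S (M *m N) = base_mx S M *m base_mx S N.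
Proof. exact: (map_mxM (unit_alg S)). Qed.

Lemma base_mx1 (S : comAlgType k) n : base_mx S (1%:M : 'M[k]_n) = 1%:M.
Proof. exact: (map_mx1 (unit_alg S)). Qed.

Lemma map_base_mx (S S' : comAlgType k) (f : {lrmorphism S -> S'}) n (M : 'M[k]_n) :
  map_mx f (base_mx S M) = base_mx S' M.
Proof. by apply/matrixP => i j; rewrite !mxE /= linearZ rmorph1. Qed.

Variables (a : ptPi k) (M : 'M[k]_9).
Variable Q : forall S : comAlgType k, set (Proj k 8 S).
Hypothesis Q_fmap : forall (S S' : comAlgType k) (f : {lrmorphism S -> S'}) (L : Proj k 8 S),
  Q L -> Q (Defs.fmap f L).
Hypothesis unitM : M \in unitmx.
Arguments Q {S}.
Let a_ (S : comAlgType k) : ptPi S := ptPi_map (unit_alg S) (a : ptPi k^o).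

Let MV (S : comAlgType k) : base_mx S M *m base_mx S (invmx M) = 1%:M.
Proof. by rewrite -base_mxM mulmxV // base_mx1. Qed.

Let VM (S : comAlgType k) : base_mx S (invmx M) *m base_mx S M = 1%:M.
Proof. by rewrite -base_mxM mulVmx // base_mx1. Qed.

Let push (S : comAlgType k) (L : Proj k 8 S) : Proj k 8 S :=
  exist _ (lin_image (base_mx S M) (sval L)) (lin_image_line (@MV S) (svalP L)).

Let pull (S : comAlgType k) (L : Proj k 8 S) : Proj k 8 S :=
  exist _ (lin_image (base_mx S (invmx M)) (sval L)) (lin_image_line (@VM S) (svalP L)).

Let pushK (S : comAlgType k) : cancel (@push S) (@pull S).
Proof. by move=> L; apply: sval_inj; exact/lin_imageK/MV. Qed.

Let pullK (S : comAlgType k) : cancel (@pull S) (@push S).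
Proof. by move=> L; apply: sval_inj; exact/lin_imageK/VM. Qed.

(** The base component of a point of the fibre is forced to be the image of [a], so only the line
    matters. It is moved by [M] and back by [invmx M], naturally in [S] because [M] has entries in
    [k]. *)
Lemma fibre_coordinates :
  (forall (S : comAlgType k) (L : Proj k 8 S),
    (forall z, sval L z -> eqPi z (a_ S) = 0) <-> Q (push L)) ->
  isomorphic (fibre (rhoPi k) a) (subF Q_fmap).
Proof.
move=> QP.
have to_Q (S : comAlgType k) (x : fibre (rhoPi k) a S) : Q (push (sval (sval x)).1).
  by case: x => [[[L b] /= Lb]] /= bE; apply/QP => z /Lb /=; rewrite bE.
pose toF (S : comAlgType k) (x : fibre (rhoPi k) a S) : subF Q_fmap S :=
  exist _ (push (sval (sval x)).1) (to_Q S x).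
have nat_toF (S S' : comAlgType k) (f : {lrmorphism S -> S'}) (x : fibre (rhoPi k) a S) :
    toF S' (Defs.fmap f x) = Defs.fmap f (toF S x).
  apply: sval_inj; apply: sval_inj => /=.
  by rewrite line_map_lin_image map_base_mx.
exists (Morphism nat_toF) => S /=.
have from_Pi (y : subF Q_fmap S) : on_PiHat (pull (sval y), a_ S).
  by case: y => [L QL] /= z; apply: (QP S (pull L)).2; rewrite pullK.
pose fromF (y : subF Q_fmap S) : fibre (rhoPi k) a S :=
  exist _ (exist _ (pull (sval y), a_ S) (from_Pi y)) erefl.
exists fromF => [[[[L b] Lb] /= bE]|y].
  by apply: sval_inj; apply: sval_inj => /=; rewrite pushK bE.
by apply: sval_inj => /=; rewrite pullK.
Qed.

End FibreCoordinates.

(** * The Segre embedding *)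

Section Tensor.
Variables (S : comNzRingType) (p q n : nat).
Variables (r : 'I_n -> 'I_p) (c : 'I_n -> 'I_q).

Definition outer (x : 'rV[S]_p) (y : 'rV[S]_q) : 'rV[S]_n :=
  \row_h (x 0 (r h) * y 0 (c h)).

Lemma outerDl a x x' y : outer (a *: x + x') y = a *: outer x y + outer x' y.
Proof. by apply/rowP => h; rewrite !mxE mulrDl mulrA. Qed.

Lemma outerDr a x y y' : outer x (a *: y + y') = a *: outer x y + outer x y'.
Proof. by apply/rowP => h; rewrite !mxE mulrDr mulrCA. Qed.

Lemma outer0l y : outer 0 y = 0.
Proof. by apply/rowP => h; rewrite !mxE mul0r. Qed.

Lemma outer0r x : outer x 0 = 0.
Proof. by apply/rowP => h; rewrite !mxE mulr0. Qed.

Lemma outerZ a b x y : outer (a *: x) (b *: y) = (a * b) *: outer x y.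
Proof. by apply/rowP => h; rewrite !mxE mulrACA. Qed.

Definition tensor (L1 : set 'rV[S]_p) (L2 : set 'rV[S]_q) : set 'rV[S]_n :=
  submod_span [set outer x y | x in L1 & y in L2].

(** Bilinearity of [outer] lets the two spans be treated one after the other. *)
Lemma outer_span (G1 : set 'rV[S]_p) (G2 : set 'rV[S]_q) (L : set 'rV[S]_n) :
  is_submod L -> (forall x y, G1 x -> G2 y -> L (outer x y)) ->
  forall x y, submod_span G1 x -> submod_span G2 y -> L (outer x y).
Proof.
move=> subL LG x y xG; move: y; apply: submod_span_ind; first split => /=.
- by rewrite outer0r; exact: subL.1.
- by move=> a y y' Ly Ly'; rewrite outerDr; apply: subL.2.
move=> y Gy; move: x xG; apply: submod_span_ind; first split => /=.
- by rewrite outer0l; exact: subL.1.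
- by move=> a x x' Lx Lx'; rewrite outerDl; apply: subL.2.
- by move=> x Gx; exact: LG.
Qed.

End Tensor.

Section Columns.
Variables (S : comNzRingType) (p q n : nat) (idx : 'I_p -> 'I_q -> 'I_n).

Definition column (j : 'I_q) (z : 'rV[S]_n) : 'rV[S]_p := \row_i z 0 (idx i j).

Lemma columnZ a j z : column j (a *: z) = a *: column j z.
Proof. by apply/rowP => i; rewrite !mxE. Qed.

Lemma columnD j z z' : column j (z + z') = column j z + column j z'.
Proof. by apply/rowP => i; rewrite !mxE. Qed.

Lemma column0 j : column j 0 = 0.
Proof. by apply/rowP => i; rewrite !mxE. Qed.

Definition columns (L : set 'rV[S]_n) : set 'rV[S]_p :=
  submod_span [set column j z | j in setT & z in L].

(** With [idx] arranging the entries of [z] as a [p] by [q] matrix, these are its 2 x 2 minors. *)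
Definition rank_one (z : 'rV[S]_n) : Prop := forall i i' j j',
  z 0 (idx i j) * z 0 (idx i' j') = z 0 (idx i j') * z 0 (idx i' j).

End Columns.

Lemma rank_one_flip (S : comNzRingType) p q n (idx : 'I_p -> 'I_q -> 'I_n) (z : 'rV[S]_n) :
  rank_one idx z -> rank_one (fun j i => idx i j) z.
Proof. by move=> z1 j j' i i'; rewrite z1 mulrC. Qed.

Section SegreLines.
Variables (S : comNzRingType) (p q n : nat).
Variables (r : 'I_n -> 'I_p) (c : 'I_n -> 'I_q) (idx : 'I_p -> 'I_q -> 'I_n).
Hypothesis rK : forall i j, r (idx i j) = i.
Hypothesis cK : forall i j, c (idx i j) = j.
Hypothesis idxK : forall h, idx (r h) (c h) = h.

Lemma column_outer j (x : 'rV[S]_p) (y : 'rV[S]_q) : column idx j (outer r c x y) = y 0 j *: x.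
Proof. by apply/rowP => i; rewrite !mxE rK cK mulrC. Qed.

(** Over a ring a rank one matrix factors only where one of its entries is invertible: times an
    entry, it is the product of the column and the row through that entry. *)
Lemma rank_one_outer (l : 'rV[S]_n) h : rank_one idx l ->
  outer r c (column idx (c h) l) (column (fun j i => idx i j) (r h) l) = l 0 h *: l.
Proof. by move=> l1; apply/rowP => h'; rewrite !mxE l1 !idxK mulrC. Qed.

Lemma tensor_chart_scale (L1 : set 'rV[S]_p) (L2 : set 'rV[S]_q) g1 g2 l1 l2 :
  (forall x, L1 x -> exists a, g1 *: x = a *: l1) ->
  (forall y, L2 y -> exists a, g2 *: y = a *: l2) ->
  forall z, tensor r c L1 L2 z -> exists a, (g1 * g2) *: z = a *: outer r c l1 l2.
Proof.
move=> lx1 lx2; apply: submod_span_ind; first split => /=.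
- by exists 0; rewrite scaler0 scale0r.
- move=> a x y [b xE] [b' yE]; exists (a * b + b').
  by rewrite scalerDr scalerA [_ * a]mulrC -(scalerA a) xE yE scalerDl scalerA.
- move=> _ [x Lx [y Ly <-]]; have [b bE] := lx1 x Lx; have [b' bE'] := lx2 y Ly.
  by exists (b * b'); rewrite -!outerZ bE bE'.
Qed.

Lemma tensor_line_chart (L1 : set 'rV[S]_p) (L2 : set 'rV[S]_q) g1 g2 :
  line_chart L1 g1 -> line_chart L2 g2 -> line_chart (tensor r c L1 L2) (g1 * g2).
Proof.
move=> [l1 [Ll1 [d1 dE1] lx1]] [l2 [Ll2 [d2 dE2] lx2]]; exists (outer r c l1 l2); split.
- by apply: submod_span_gen; exists l1 => //; exists l2.
- exists (fun h => d1 (r h) * d2 (c h)).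
  rewrite -dE1 -dE2 mulr_suml; under [RHS]eq_bigr do rewrite mulr_sumr.
  rewrite pair_big (reindex (fun h => (r h, c h))) /=.
    by apply: eq_bigr => h _; rewrite mxE mulrACA.
  exists (fun ij => idx ij.1 ij.2) => [h _ /=|[i j] _ /=]; first exact: idxK.
  by rewrite rK cK.
- exact: tensor_chart_scale.
Qed.

Lemma tensor_line (L1 : set 'rV[S]_p) (L2 : set 'rV[S]_q) :
  is_line L1 -> is_line L2 -> is_line (tensor r c L1 L2).
Proof.
move=> line1 line2; apply: is_line_cover; first exact: submod_span_submod.
move=> I idI IL; apply: (line_cover2 line1 line2 idI) => g1 g2 chart1 chart2.
by exists 1%N; rewrite expr1; apply: IL; exact: tensor_line_chart.
Qed.

(** A sum of rank one matrices need not have rank one, but on a chart the tensor product is spanned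
    by a single outer product. Hence [(g1 * g2) ^+ 2] kills each minor [w], and the annihilator of
    [w] contains 1. *)
Lemma tensor_rank_one (L1 : set 'rV[S]_p) (L2 : set 'rV[S]_q) :
  is_line L1 -> is_line L2 -> forall z, tensor r c L1 L2 z -> rank_one idx z.
Proof.
move=> line1 line2 z Lz i i' j j'; apply/eqP; rewrite -subr_eq0; apply/eqP.
set w := _ - _; have idI : is_ideal [set a | a * w = 0].
  split=> [|a x y xw yw] /=; first by rewrite mul0r.
  by rewrite mulrDl -mulrA xw yw mulr0 addr0.
rewrite -[w]mul1r.
apply: (line_cover2 line1 line2 idI) => g1 g2 [l1 [_ _ lx1]] [l2 [_ _ lx2]]; exists 2 => /=.
have [a zE] := tensor_chart_scale lx1 lx2 Lz.
have aE h : g1 * g2 * z 0 h = a * (l1 0 (r h) * l2 0 (c h)).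
  by have := congr1 (fun v : 'rV_n => v 0 h) zE; rewrite !mxE.
by rewrite /w mulrBr expr2 ![_ * _ * (z _ _ * _)]mulrACA !aE !rK !cK; ring.
Qed.

(** To recover [x] from the columns, take a generator [l] on a chart of [L2]: the columns of
    [outer r c x l] are the multiples of [x] by the coordinates of [l], which generate the chart
    function. *)
Lemma columns_tensor (L1 : set 'rV[S]_p) (L2 : set 'rV[S]_q) : is_line L1 -> is_line L2 ->
  columns idx (tensor r c L1 L2) = L1.
Proof.
move=> [sub1 _] line2; apply/seteqP; split.
  apply: submod_span_ind => // _ [j _ [z Lz <-]]; move: z Lz.
  apply: submod_span_ind; first split => /=.
  - by rewrite column0; exact: sub1.1.
  - by move=> a x y Lx Ly; rewrite columnD columnZ; apply: sub1.2.
  - by move=> _ [x Lx [y Ly <-]]; rewrite /= column_outer; exact: submodZ.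
move=> x Lx; rewrite -[x]scale1r.
have subC : is_submod (columns idx (tensor r c L1 L2)) := submod_span_submod _.
apply: (line_cover line2 (colon_ideal subC x)) => _ [l [Ll [d <-] _]] /=.
rewrite scaler_suml; apply: (submod_sum subC) => j _; rewrite -scalerA.
apply: (submodZ subC); rewrite -column_outer; apply: submod_span_gen.
exists j => //; exists (outer r c x l) => //.
by apply: submod_span_gen; exists x => //; exists l.
Qed.

(** Each chart of [L], with generator [l], is cut further by the entries of [l]. Where the entry [h]
    is invertible, vanishing of the minors makes every column a multiple of the column of [l]
    through [h]. The square of [g] is a combination of the products [l 0 h * g]. *)
Lemma columns_line (L : set 'rV[S]_n) : is_line L -> (forall z, L z -> rank_one idx z) ->
  is_line (columns idx L).
Proof.
move=> lineL L1; apply: is_line_cover; first exact: submod_span_submod.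
move=> I idI IL; apply: (line_cover_exp lineL idI) => g [l [Ll [d dE] lx]]; exists 2.
rewrite expr2 -{1}dE mulr_suml; apply: (ideal_sum idI) => h _; rewrite -mulrA.
apply: (idealMl idI); apply: IL; exists (column idx (c h) l); split.
- by apply: submod_span_gen; exists (c h) => //; exists l.
- exists (fun i => if i == r h then g else 0).
  rewrite (bigD1 (r h)) //= eqxx big1 ?addr0 => [|i /negbTE->]; last by rewrite mul0r.
  by rewrite mxE idxK mulrC.
- apply: submod_span_ind; first split => /=.
  + by exists 0; rewrite scaler0 scale0r.
  + move=> a x y [b xE] [b' yE]; exists (a * b + b').
    by rewrite scalerDr scalerA [_ * a]mulrC -(scalerA a) xE yE scalerDl scalerA.
  + move=> _ [j _ [z Lz <-]]; have [b bE] := lx z Lz; exists (b * l 0 (idx (r h) j)).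
    rewrite -scalerA -columnZ bE; apply/rowP => i; rewrite !mxE.
    by rewrite mulrCA -{1}(idxK h) -mulrA [l _ _ * l _ (idx i _)]L1.
Qed.

End SegreLines.

Section SegreInverse.
Variables (S : comNzRingType) (p q n : nat).
Variables (r : 'I_n -> 'I_p) (c : 'I_n -> 'I_q) (idx : 'I_p -> 'I_q -> 'I_n).
Hypothesis rK : forall i j, r (idx i j) = i.
Hypothesis cK : forall i j, c (idx i j) = j.
Hypothesis idxK : forall h, idx (r h) (c h) = h.

Local Notation rows := (columns (fun j i => idx i j)).

Lemma tensor_flip (L1 : set 'rV[S]_p) (L2 : set 'rV[S]_q) :
  tensor r c L1 L2 = tensor c r L2 L1.
Proof.
rewrite /tensor; congr submod_span; apply/seteqP.
by split=> _ [x Lx [y Ly <-]]; exists y => //; exists x => //;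
  apply/rowP => h; rewrite !mxE mulrC.
Qed.

Lemma rows_tensor (L1 : set 'rV[S]_p) (L2 : set 'rV[S]_q) : is_line L1 -> is_line L2 ->
  rows (tensor r c L1 L2) = L2.
Proof.
by move=> line1 line2; rewrite tensor_flip; exact: columns_tensor.
Qed.

Lemma rows_line (L : set 'rV[S]_n) : is_line L -> (forall z, L z -> rank_one idx z) ->
  is_line (rows L).
Proof.
move=> lineL L1; apply: (columns_line (r := c) (c := r)) => //.
by move=> z /L1; exact: rank_one_flip.
Qed.

(** Both inclusions are checked on the charts of [L] through colon ideals, where [rank_one_outer]
    turns a column times a row of the generator [l] into an entry of [l] times [l], and
    conversely. *)
Lemma tensor_columns_rows (L : set 'rV[S]_n) :
  is_line L -> (forall z, L z -> rank_one idx z) ->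
  tensor r c (columns idx L) (rows L) = L.
Proof.
move=> lineL L1; have subL := lineL.1; apply/seteqP; split.
  apply: submod_span_ind => // _ [x Lx [y Ly <-]]; move: Ly; move: x y Lx.
  apply: outer_span => // _ _ [j _ [z Lz <-]] [i _ [z' Lz' <-]].
  rewrite -[X in L X]scale1r.
  apply: (line_cover_exp lineL (colon_ideal subL _)) => g [l [Ll _ lx]]; exists 2 => /=.
  have [b bE] := lx z Lz; have [b' bE'] := lx z' Lz'.
  rewrite expr2 -outerZ -!columnZ bE bE' !columnZ outerZ.
  have := rank_one_outer (r := r) (c := c) idxK (idx i j) (L1 l Ll).
  by rewrite rK cK => ->; do 2 apply: submodZ => //.
move=> z Lz; rewrite -[z]scale1r.
have subT : is_submod (tensor r c (columns idx L) (rows L)) := submod_span_submod _.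
apply: (line_cover_exp lineL (colon_ideal subT z)) => g [l [Ll [d dE] lx]]; exists 2 => /=.
have [b bE] := lx z Lz.
rewrite expr2 -scalerA bE scalerA mulrC -scalerA -dE scaler_suml.
apply: (submodZ subT); apply: (submod_sum subT) => h _; rewrite -scalerA.
apply: (submodZ subT); rewrite -(rank_one_outer (r := r) (c := c) idxK h (L1 l Ll)).
apply: submod_span_gen; exists (column idx (c h) l).
  by apply: submod_span_gen; exists (c h) => //; exists l.
exists (column (fun j i => idx i j) (r h) l) => //.
by apply: submod_span_gen; exists (r h) => //; exists l.
Qed.

End SegreInverse.

Section SegreEmbedding.
Variables (k : comNzRingType) (p q n : nat).
Variables (r : 'I_n.+1 -> 'I_p.+1) (c : 'I_n.+1 -> 'I_q.+1).
Variable idx : 'I_p.+1 -> 'I_q.+1 -> 'I_n.+1.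
Hypothesis rK : forall i j, r (idx i j) = i.
Hypothesis cK : forall i j, c (idx i j) = j.
Hypothesis idxK : forall h, idx (r h) (c h) = h.

Lemma line_map_tensor (S S' : comNzRingType) (f : {rmorphism S -> S'})
    (L1 : set 'rV[S]_p.+1) (L2 : set 'rV[S]_q.+1) :
  line_map f (tensor r c L1 L2) = tensor r c (line_map f L1) (line_map f L2).
Proof.
have map_outer x y : map_mx f (outer r c x y) = outer r c (map_mx f x) (map_mx f y).
  by apply/rowP => h; rewrite !mxE rmorphM.
apply/seteqP; split.
  apply: submod_span_ind; first exact: submod_span_submod.
  move=> _ [z Lz <-]; move: z Lz; apply: submod_span_ind; first split => /=.
  - by rewrite map_mx0; exact: (submod_span_submod _).1.
  - by move=> a x y Lx Ly; rewrite map_mxD map_mxZ; apply: (submod_span_submod _).2.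
  - move=> _ [x Lx [y Ly <-]] /=; rewrite map_outer; apply: submod_span_gen.
    by exists (map_mx f x); [|exists (map_mx f y)] => //;
      apply: submod_span_gen; [exists x | exists y].
apply: submod_span_ind; first exact: submod_span_submod.
move=> _ [x Lx [y Ly <-]]; move: Ly; move: x y Lx; apply: outer_span.
  exact: submod_span_submod.
move=> _ _ [x Lx <-] [y Ly <-]; rewrite -map_outer; apply: submod_span_gen.
by exists (outer r c x y) => //; apply: submod_span_gen; exists x => //; exists y.
Qed.

Definition on_segre (S : comAlgType k) (L : Proj k n S) : Prop :=
  forall z, sval L z -> rank_one idx z.

Lemma on_segre_fmap (S S' : comAlgType k) (f : {lrmorphism S -> S'}) (L : Proj k n S) :
  on_segre L -> on_segre (Defs.fmap f L).
Proof.
move=> LP y Ly i i' j j'; apply/eqP; rewrite -subr_eq0; apply/eqP.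
(* The minor is viewed as a quadratic map into 1 x 1 matrices, the form that [line_map_vanish]
   takes. *)
pose Q (z : 'rV[S']_n.+1) : 'M[S']_1 :=
  const_mx (z 0 (idx i j) * z 0 (idx i' j') - z 0 (idx i j') * z 0 (idx i' j)).
have /matrixP/(_ 0 0) : Q y = 0; last by rewrite !mxE.
apply: (line_map_vanish (svalP L) _ _ Ly) => [a z|z Lz].
  by apply/matrixP => u v; rewrite !mxE; ring.
by apply/matrixP => u v; rewrite !mxE -!rmorphM LP // subrr.
Qed.

Definition Segre : kfunctor k := subF on_segre_fmap.

(* The inverse sends a line of rank one matrices to the span of its columns and
   the span of its rows. *)
Lemma segre_embedding : isomorphic (prodF (Proj k p) (Proj k q)) Segre.
Proof.
pose toF (S : comAlgType k) (x : prodF (Proj k p) (Proj k q) S) : Segre S :=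
  exist _ (exist _ (tensor r c (sval x.1) (sval x.2))
                   (tensor_line rK cK idxK (svalP x.1) (svalP x.2)) : Proj k n S)
    (tensor_rank_one rK cK (svalP x.1) (svalP x.2)).
have nat_toF (S S' : comAlgType k) (f : {lrmorphism S -> S'}) x :
    toF S' (Defs.fmap f x) = Defs.fmap f (toF S x).
  by apply: sval_inj; apply: sval_inj => /=; rewrite line_map_tensor.
exists (Morphism nat_toF) => S /=.
pose fromF (y : Segre S) : prodF (Proj k p) (Proj k q) S :=
  (exist _ (columns idx (sval (sval y))) (columns_line idxK (svalP (sval y)) (svalP y)),
   exist _ (columns (fun j i => idx i j) (sval (sval y)))
     (rows_line idxK (svalP (sval y)) (svalP y))).
exists fromF => [[[L1 l1] [L2 l2]]|y].
  rewrite /fromF /toF /=; congr pair; apply: sval_inj => /=.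
    exact: columns_tensor.
  exact: rows_tensor.
by apply: sval_inj; apply: sval_inj => /=; apply: tensor_columns_rows => //;
  [exact: svalP (sval y) | exact: svalP y].
Qed.

End SegreEmbedding.

(** * Coordinates at the roots of the cubic *)

Section SplitCoordinates.
Variable S : comNzRingType.

(* The map LtoP solved for the L's: n_i and m_i are the fractions that it adds to
   L245 and - L136.  As n1 + n2 + n3 = m1 + m2 + m3 = 0, these parameters make the
   L's, and all identities below, free of denominators. *)
Definition split_pt (A B l k n1 n2 m1 m2 x y : S) : ptPi S :=
  let L126 := - (n1 * (2 * A + B) + n2 * (A + 2 * B)) in
  let L125 := - (m1 * (2 * A + B) + m2 * (A + 2 * B)) in
  PtPi (- A ^+ 2 - A * B - B ^+ 2) (- (A * B * (A + B)))
    (PtL (m1 * (A - B) * (2 * A + B) + A * L125) (n1 * (A - B) * (2 * A + B) + A * L126)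
       L125 L126 y k l (- x)).

Definition split_tensor (l k n1 n2 m1 m2 x y : S) : ptP S :=
  {| p111 := x; p211 := l + n1; p121 := l + n2; p112 := l - n1 - n2;
     p122 := m1 - k; p212 := m2 - k; p221 := - m1 - m2 - k; p222 := y |}.

(* The cyclic permutation of the indices of p_ijk that goes with the permutation
   A -> B -> - A - B -> A of the roots. *)
Definition rot (a : ptP S) : ptP S :=
  {| p111 := p111 a; p211 := p121 a; p121 := p112 a; p112 := p211 a;
     p122 := p212 a; p212 := p221 a; p221 := p122 a; p222 := p222 a |}.

Definition coordX (A : S) (z : 'rV[S]_9) := z 0 4 - A * z 0 0 - A ^+ 2 * z 0 1.
Definition coordY (A : S) (z : 'rV[S]_9) := z 0 5 - A * z 0 2 - A ^+ 2 * z 0 3.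
(** With C = - A - B, n3 = - n1 - n2 and m3 = - m1 - m2 this is B C s1 + A s2 + s3 + m3 X2 + n3 Y2 +
    m2 X3 + n2 Y3, invariant under exchange of the indices 2 and 3. The coefficient B C equals t1 +
    A^2. *)
Definition coordU (A B n1 n2 m1 m2 : S) (z : 'rV[S]_9) :=
  - (B * (A + B)) * z 0 6 + A * z 0 7 + z 0 8
  - (m1 + m2) * coordX B z - (n1 + n2) * coordY B z
  + m2 * coordX (- A - B) z + n2 * coordY (- A - B) z.

(** In [eqX] and [eqY] the quadratic parts are the two partial derivatives of the trilinear form in
    its first argument at (- Y2, X2), (- Y3, X3); in [eqU] the determinant is that of its
    contraction with (- Y1, X1). The other arguments are reached through [rot]. *)
Definition eqX (a : ptP S) (X1 u1 X2 Y2 X3 Y3 : S) : S :=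
  X1 * u1 + p111 a * Y2 * Y3 - p112 a * Y2 * X3 - p121 a * X2 * Y3 + p122 a * X2 * X3.
Definition eqY (a : ptP S) (Y1 u1 X2 Y2 X3 Y3 : S) : S :=
  Y1 * u1 + p211 a * Y2 * Y3 - p212 a * Y2 * X3 - p221 a * X2 * Y3 + p222 a * X2 * X3.
Definition eqU (a : ptP S) (X1 Y1 u2 u3 : S) : S :=
  u2 * u3 + (p211 a * X1 - p111 a * Y1) * (p222 a * X1 - p122 a * Y1)
  - (p212 a * X1 - p112 a * Y1) * (p221 a * X1 - p121 a * Y1).

(** The weights t1 + A^2, A, 1 are the coefficients of the quotient of x^3 + t1 x - t2 by x - A. *)
Lemma split_eqX (A B l k n1 n2 m1 m2 x y : S) (z : 'rV[S]_9) :
  let a := split_pt A B l k n1 n2 m1 m2 x y in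
  (t1 a + A ^+ 2) * F1 z a + A * F3 z a + F5 z a
  = eqX (split_tensor l k n1 n2 m1 m2 x y) (coordX A z) (coordU A B n1 n2 m1 m2 z)
      (coordX B z) (coordY B z) (coordX (- A - B) z) (coordY (- A - B) z).
Proof.
rewrite /F1 /F3 /F5 /lam /U1 /U2 /U3 /I1 /I2 /I3 /W1 /W2 /W3 /Delta.
rewrite /eqX /coordU /coordX /coordY /=; ring.
Qed.

Lemma split_eqY (A B l k n1 n2 m1 m2 x y : S) (z : 'rV[S]_9) :
  let a := split_pt A B l k n1 n2 m1 m2 x y in
  (t1 a + A ^+ 2) * F2 z a + A * F4 z a + F6 z a
  = eqY (split_tensor l k n1 n2 m1 m2 x y) (coordY A z) (coordU A B n1 n2 m1 m2 z)
      (coordX B z) (coordY B z) (coordX (- A - B) z) (coordY (- A - B) z).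
Proof.
rewrite /F2 /F4 /F6 /mu /U1 /U2 /U3 /I1 /I2 /I3 /W1 /W2 /W3 /Delta.
rewrite /eqY /coordU /coordX /coordY /=; ring.
Qed.

(** The combination equals [eqU] only up to multiples of the [eqX] and [eqY] at the three roots,
    which is harmless once those vanish. *)
Lemma split_eqU (A B l k n1 n2 m1 m2 x y : S) (z : 'rV[S]_9) :
  let a := split_pt A B l k n1 n2 m1 m2 x y in
  let e := split_tensor l k n1 n2 m1 m2 x y in
  let C := - A - B in let n3 := - n1 - n2 in let m3 := - m1 - m2 in
  let u1 := coordU A B n1 n2 m1 m2 z in
  let u2 := coordU B C n2 n3 m2 m3 z in
  let u3 := coordU C A n3 n1 m3 m1 z in
  F9 z a - A * F8 z a - A ^+ 2 * F7 z a = eqU e (coordX A z) (coordY A z) u2 u3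
   + m1 * (eqX e (coordX A z) u1 (coordX B z) (coordY B z) (coordX C z) (coordY C z)
    - eqX (rot e) (coordX B z) u2 (coordX C z) (coordY C z) (coordX A z) (coordY A z)
    - eqX (rot (rot e)) (coordX C z) u3 (coordX A z) (coordY A z) (coordX B z) (coordY B z))
   + n1 * (eqY e (coordY A z) u1 (coordX B z) (coordY B z) (coordX C z) (coordY C z)
    - eqY (rot e) (coordY B z) u2 (coordX C z) (coordY C z) (coordX A z) (coordY A z)
    - eqY (rot (rot e)) (coordY C z) u3 (coordX A z) (coordY A z) (coordX B z) (coordY B z)).
Proof.
rewrite /F9 /F8 /F7 /lam /mu /kappa1 /kappa2 /kappa3 /Delta.
rewrite /eqX /eqY /eqU /coordU /coordX /coordY /=; ring.
Qed.

Definition eq3 (e : ptP S) (X1 Y1 u1 X2 Y2 u2 X3 Y3 u3 : S) : Prop :=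
  [/\ eqX e X1 u1 X2 Y2 X3 Y3 = 0, eqY e Y1 u1 X2 Y2 X3 Y3 = 0 & eqU e X1 Y1 u2 u3 = 0].

(* Row coordinates X1, X2, X3, Y1, Y2, Y3, u1, u2, u3. *)
Definition tensor_eqs (e : ptP S) (y : 'rV[S]_9) : Prop :=
  [/\ eq3 e (y 0 0) (y 0 3) (y 0 6) (y 0 1) (y 0 4) (y 0 7) (y 0 2) (y 0 5) (y 0 8),
      eq3 (rot e) (y 0 1) (y 0 4) (y 0 7) (y 0 2) (y 0 5) (y 0 8) (y 0 0) (y 0 3) (y 0 6)
    & eq3 (rot (rot e)) (y 0 2) (y 0 5) (y 0 8) (y 0 0) (y 0 3) (y 0 6) (y 0 1) (y 0 4) (y 0 7)].

Definition split_row (A B n1 n2 m1 m2 : S) (z : 'rV[S]_9) : 'rV[S]_9 :=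
  let C := - A - B in let n3 := - n1 - n2 in let m3 := - m1 - m2 in
  \row_(h < 9) [:: coordX A z; coordX B z; coordX C z; coordY A z; coordY B z; coordY C z;
    coordU A B n1 n2 m1 m2 z; coordU B C n2 n3 m2 m3 z; coordU C A n3 n1 m3 m1 z]`_h.

Lemma eqPi_eq0 (z : 'rV[S]_9) (a : ptPi S) : eqPi z a = 0 <->
  [/\ [/\ F1 z a = 0, F3 z a = 0 & F5 z a = 0], [/\ F2 z a = 0, F4 z a = 0 & F6 z a = 0]
    & [/\ F7 z a = 0, F8 z a = 0 & F9 z a = 0]].
Proof.
split=> [/rowP F0|[[E1 E3 E5] [E2 E4 E6] [E7 E8 E9]]]; last first.
  apply/rowP => i; rewrite !mxE; by case: i => [[|[|[|[|[|[|[|[|[|i]]]]]]]]] Hi] //=.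
by move: (F0 0) (F0 1) (F0 2) (F0 3) (F0 4) (F0 5) (F0 6) (F0 7) (F0 8); rewrite !mxE.
Qed.

(** The element inverted by [d] is the Vandermonde determinant (A - B)(A - C)(B - C), and each
    coefficient is isolated by Cramer's rule. The inverse is given explicitly because [S] is an
    arbitrary commutative ring. *)
Lemma vandermonde3 (A B d x y w : S) :
  let C := - A - B in
  d * ((A - B) * (2 * A + B) * (A + 2 * B)) = 1 ->
  A ^+ 2 * x + A * y + w = 0 -> B ^+ 2 * x + B * y + w = 0 -> C ^+ 2 * x + C * y + w = 0 ->
  [/\ x = 0, y = 0 & w = 0].
Proof.
move=> C d1 fA fB fC; split; rewrite -[LHS]mul1r -d1.
- transitivity (d * ((B - C) * (A ^+ 2 * x + A * y + w) - (A - C) * (B ^+ 2 * x + B * y + w)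
    + (A - B) * (C ^+ 2 * x + C * y + w))); first by rewrite /C; ring.
  by rewrite fA fB fC; ring.
- transitivity (- d * ((B ^+ 2 - C ^+ 2) * (A ^+ 2 * x + A * y + w)
    - (A ^+ 2 - C ^+ 2) * (B ^+ 2 * x + B * y + w)
    + (A ^+ 2 - B ^+ 2) * (C ^+ 2 * x + C * y + w))); first by rewrite /C; ring.
  by rewrite fA fB fC; ring.
- transitivity (d * (B * C * (B - C) * (A ^+ 2 * x + A * y + w)
    - A * C * (A - C) * (B ^+ 2 * x + B * y + w)
    + A * B * (A - B) * (C ^+ 2 * x + C * y + w))); first by rewrite /C; ring.
  by rewrite fA fB fC; ring.
Qed.

(** This symmetry yields the identities at the roots B and C from those at A. *)
Lemma split_pt_rot (A B l k n1 n2 m1 m2 x y : S) :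
  split_pt B (- A - B) l k n2 (- n1 - n2) m2 (- m1 - m2) x y = split_pt A B l k n1 n2 m1 m2 x y.
Proof. by rewrite /split_pt /=; congr (PtPi _ _ (PtL _ _ _ _ _ _ _ _)); ring. Qed.

Lemma rot_split_tensor (l k n1 n2 m1 m2 x y : S) :
  rot (split_tensor l k n1 n2 m1 m2 x y) = split_tensor l k n2 (- n1 - n2) m2 (- m1 - m2) x y.
Proof. by rewrite /split_tensor /rot /=; congr (PtP _ _ _ _ _ _ _ _); ring. Qed.

Lemma rot3 (e : ptP S) : rot (rot (rot e)) = e.
Proof. by case: e. Qed.

(** Going to the tensor equations takes linear combinations. Conversely, [F1], [F3], [F5], then
    [F2], [F4], [F6], then [F7], [F8], [F9] are recovered by interpolation at the three roots. *)
Lemma split_tensor_eqs (A B d l k n1 n2 m1 m2 x y : S) (z : 'rV[S]_9) :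
  d * ((A - B) * (2 * A + B) * (A + 2 * B)) = 1 ->
  eqPi z (split_pt A B l k n1 n2 m1 m2 x y) = 0 <->
  tensor_eqs (split_tensor l k n1 n2 m1 m2 x y) (split_row A B n1 n2 m1 m2 z).
Proof.
move=> d1; rewrite eqPi_eq0 /tensor_eqs !mxE /=.
set a := split_pt _ _ _ _ _ _ _ _ _ _; set e := split_tensor _ _ _ _ _ _ _ _.
set C := - A - B; set n3 := - n1 - n2; set m3 := - m1 - m2.
have CAB : - B - C = A by rewrite /C; ring.
have CBA : - C - A = B by rewrite /C; ring.
have nE1 : - n2 - n3 = n1 by rewrite /n3; ring.
have mE1 : - m2 - m3 = m1 by rewrite /m3; ring.
have nE2 : - n3 - n1 = n2 by rewrite /n3; ring.
have mE2 : - m3 - m1 = m2 by rewrite /m3; ring.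
have a2 : split_pt B C l k n2 n3 m2 m3 x y = a by exact: split_pt_rot.
have a3 : split_pt C A l k n3 n1 m3 m1 x y = a.
  by rewrite -a2 -[in RHS]split_pt_rot CAB nE1 mE1.
have e2 : rot e = split_tensor l k n2 n3 m2 m3 x y by exact: rot_split_tensor.
have e3 : rot (rot e) = split_tensor l k n3 n1 m3 m1 x y.
  by rewrite e2 rot_split_tensor nE1 mE1.
have X1 := split_eqX A B l k n1 n2 m1 m2 x y z.
have Y1 := split_eqY A B l k n1 n2 m1 m2 x y z.
have V1 := split_eqU A B l k n1 n2 m1 m2 x y z.
have X2 := split_eqX B C l k n2 n3 m2 m3 x y z.
have Y2 := split_eqY B C l k n2 n3 m2 m3 x y z.
have V2 := split_eqU B C l k n2 n3 m2 m3 x y z.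
have X3 := split_eqX C A l k n3 n1 m3 m1 x y z.
have Y3 := split_eqY C A l k n3 n1 m3 m1 x y z.
have V3 := split_eqU C A l k n3 n1 m3 m1 x y z.
cbv zeta in X1, Y1, V1, X2, Y2, V2, X3, Y3, V3.
rewrite -/a -/e -/C -/n3 -/m3 in X1 Y1 V1.
rewrite a2 -e2 CAB nE1 mE1 in X2 Y2 V2.
rewrite a3 -e3 CBA nE2 mE2 in X3 Y3 V3.
rewrite rot3 in V2; rewrite rot3 in V3.
split.
  move=> [[E1 E3 E5] [E2 E4 E6] [E7 E8 E9]].
  rewrite E1 E3 E5 !mulr0 !addr0 in X1 X2 X3.
  rewrite E2 E4 E6 !mulr0 !addr0 in Y1 Y2 Y3.
  rewrite E7 E8 E9 -?X1 -?X2 -?X3 -?Y1 -?Y2 -?Y3 !(subr0, mulr0, addr0) in V1 V2 V3.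
  by split; split.
move=> [[x1 y1 v1] [x2 y2 v2] [x3 y3 v3]].
rewrite ?x1 ?x2 ?x3 in X1 X2 X3; rewrite ?y1 ?y2 ?y3 in Y1 Y2 Y3.
rewrite ?x1 ?x2 ?x3 ?y1 ?y2 ?y3 ?v1 ?v2 ?v3 !(subr0, mulr0, addr0) in V1 V2 V3.
(* The constant term t1 f does not depend on the root, so the pencil is a quadratic polynomial in D
   with constant coefficient t1 f + h. *)
have vanish (D f g h : S) : (t1 a + D ^+ 2) * f + D * g + h = 0 ->
    D ^+ 2 * f + D * g + (t1 a * f + h) = 0.
  by move=> fgh; rewrite -[RHS]fgh; ring.
have [E1 E3] := vandermonde3 d1 (vanish _ _ _ _ X1) (vanish _ _ _ _ X2) (vanish _ _ _ _ X3).
have [E2 E4] := vandermonde3 d1 (vanish _ _ _ _ Y1) (vanish _ _ _ _ Y2) (vanish _ _ _ _ Y3).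
rewrite E1 E2 mulr0 !add0r => E6 E5.
have vanish' (D f g h : S) : h - D * g - D ^+ 2 * f = 0 ->
    D ^+ 2 * (- f) + D * (- g) + h = 0.
  by move=> fgh; rewrite -[RHS]fgh; ring.
have [/eqP + /eqP] :=
  vandermonde3 d1 (vanish' _ _ _ _ V1) (vanish' _ _ _ _ V2) (vanish' _ _ _ _ V3).
by rewrite !oppr_eq0 => /eqP E7 /eqP E8 E9.
Qed.

End SplitCoordinates.

(** * Natural linear changes of coordinates *)

Section CoordinateChange.
Variables (k : fieldType) (n : nat).

(** Injectivity over [k] is enough: by linearity and naturality [phi] is multiplication by one
    matrix over [k], and if that is invertible, so is its image over every [S]. *)
Definition coordinate_change (phi : forall S : comAlgType k, 'rV[S]_n -> 'rV[S]_n) : Prop :=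
  [/\ forall (S : comAlgType k) c x y, phi S (c *: x + y) = c *: phi S x + phi S y,
      forall (S S' : comAlgType k) (f : {lrmorphism S -> S'}) x,
        map_mx f (phi S x) = phi S' (map_mx f x)
    & forall z : 'rV[k^o]_n, phi k^o z = 0 -> z = 0].

Lemma coordinate_change_comp phi psi :
  coordinate_change phi -> coordinate_change psi ->
  coordinate_change (fun S z => psi S (phi S z)).
Proof.
move=> [lphi nphi kphi] [lpsi npsi kpsi]; split=> [S c x y|S S' f x|z /kpsi/kphi] //.
  by rewrite lphi lpsi.
by rewrite npsi nphi.
Qed.

(** The rows of [M] are the images of the basis vectors over [k^o]; naturality along the structure
    map carries them to every [S]. *)
Lemma coordinate_change_mx phi : coordinate_change phi ->
  exists2 M : 'M[k]_n, M \in unitmx & forall S z, phi S z = z *m base_mx S M.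
Proof.
move=> [lphi nphi kphi].
pose M : 'M[k^o]_n := \matrix_i phi k^o (delta_mx 0 i).
have phi0 (S : comAlgType k) : phi S 0 = 0.
  by have := lphi S (-1) 0 0; rewrite scaler0 addr0 scaleN1r addNr.
have phiE (S : comAlgType k) (z : 'rV[S]_n) : phi S z = z *m base_mx S (M : 'M[k]_n).
  rewrite [z in LHS]row_sum_delta mulmx_sum_row.
  have -> (r : seq 'I_n) : phi S (\sum_(j <- r) z 0 j *: delta_mx 0 j)
      = \sum_(j <- r) z 0 j *: phi S (delta_mx 0 j).
    elim: r => [|j r IH]; first by rewrite !big_nil.
    by rewrite !big_cons lphi IH.
  apply: eq_bigr => j _; congr (_ *: _).
  rewrite -map_row rowK nphi; congr (phi S _).
  by apply/rowP => i; rewrite !mxE rmorph_nat.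
exists M => //; rewrite -row_free_unit; apply: inj_row_free => z zM.
apply: (kphi z); rewrite phiE (_ : base_mx _ _ = M) //.
by apply/matrixP => i j; rewrite mxE /= /unit_fun; exact: mulr1.
Qed.

End CoordinateChange.

Lemma fibre_coordinate_change (k : fieldType) (a : ptPi k)
    (phi : forall S : comAlgType k, 'rV[S]_9 -> 'rV[S]_9)
    (E : forall S : comAlgType k, 'rV[S]_9 -> Prop)
    (E_fmap : forall (S S' : comAlgType k) (f : {lrmorphism S -> S'}) (L : Proj k 8 S),
      (forall z, sval L z -> E S z) -> forall z, sval (Defs.fmap f L) z -> E S' z) :
  coordinate_change phi ->
  (forall (S : comAlgType k) z,
    eqPi z (ptPi_map (unit_alg S) (a : ptPi k^o)) = 0 <-> E S (phi S z)) ->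
  isomorphic (fibre (rhoPi k) a) (subF E_fmap).
Proof.
move=> /coordinate_change_mx[M unitM phiE] EP.
apply: (@fibre_coordinates k a M _ E_fmap unitM) => S L /=.
split=> [LE _ [z Lz <-]|LE z Lz]; first by rewrite -phiE; apply/EP/LE.
by apply/EP; rewrite phiE; apply: LE; exists z.
Qed.

Lemma row9_eq0 (S : comNzRingType) (z : 'rV[S]_9) :
  z 0 0 = 0 -> z 0 1 = 0 -> z 0 2 = 0 -> z 0 3 = 0 -> z 0 4 = 0 -> z 0 5 = 0 ->
  z 0 6 = 0 -> z 0 7 = 0 -> z 0 8 = 0 -> z = 0.
Proof.
move=> z0 z1 z2 z3 z4 z5 z6 z7 z8; apply/rowP => i; rewrite mxE.
case: i => [[|[|[|[|[|[|[|[|[|i]]]]]]]]] Hi] //.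
- by rewrite -z0; congr (z _ _); apply: val_inj.
- by rewrite -z1; congr (z _ _); apply: val_inj.
- by rewrite -z2; congr (z _ _); apply: val_inj.
- by rewrite -z3; congr (z _ _); apply: val_inj.
- by rewrite -z4; congr (z _ _); apply: val_inj.
- by rewrite -z5; congr (z _ _); apply: val_inj.
- by rewrite -z6; congr (z _ _); apply: val_inj.
- by rewrite -z7; congr (z _ _); apply: val_inj.
- by rewrite -z8; congr (z _ _); apply: val_inj.
Qed.

Section SplitChange.
Variable S : comNzRingType.

Lemma split_row_linear (A B n1 n2 m1 m2 c : S) (z z' : 'rV[S]_9) :
  split_row A B n1 n2 m1 m2 (c *: z + z')
  = c *: split_row A B n1 n2 m1 m2 z + split_row A B n1 n2 m1 m2 z'.
Proof.
apply/rowP => i; rewrite !mxE /coordU /coordX /coordY !mxE.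
by case: i => [[|[|[|[|[|[|[|[|[|i]]]]]]]]] Hi] //=; ring.
Qed.

(** The X_i determine u, p1, p2 by interpolation and the Y_i determine v, p3, p4; the u_i are then
    left with their terms in s1, s2, s3. *)
Lemma split_row_eq0 (A B d n1 n2 m1 m2 : S) (z : 'rV[S]_9) :
  d * ((A - B) * (2 * A + B) * (A + 2 * B)) = 1 ->
  split_row A B n1 n2 m1 m2 z = 0 -> z = 0.
Proof.
move=> d1 /rowP z0.
move: (z0 0) (z0 1) (z0 2) (z0 3) (z0 4) (z0 5) (z0 6) (z0 7) (z0 8); rewrite !mxE /=.
move=> X1 X2 X3 Y1 Y2 Y3; rewrite /coordU ?X1 ?X2 ?X3 ?Y1 ?Y2 ?Y3.
rewrite (_ : - B - (- A - B) = A) ?X1 ?Y1; last by ring.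
rewrite (_ : - (- A - B) - A = B) ?X2 ?Y2; last by ring.
move=> V1 V2 V3.
have vanish (D f g h : S) : h - D * g - D ^+ 2 * f = 0 ->
    D ^+ 2 * (- f) + D * (- g) + h = 0.
  by move=> fgh; rewrite -[RHS]fgh; ring.
have [/eqP p2 /eqP p1 u] :=
  vandermonde3 d1 (vanish _ _ _ _ X1) (vanish _ _ _ _ X2) (vanish _ _ _ _ X3).
have [/eqP p4 /eqP p3 v] :=
  vandermonde3 d1 (vanish _ _ _ _ Y1) (vanish _ _ _ _ Y2) (vanish _ _ _ _ Y3).
rewrite oppr_eq0 in p2; rewrite oppr_eq0 in p1; rewrite oppr_eq0 in p3; rewrite oppr_eq0 in p4.
(* As B C = A^2 + t1, these are values at the roots of the quadratic polynomial with coefficients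
   s1, s2 and t1 s1 + s3. *)
have [||| s1 s2] := vandermonde3 (x := z 0 6) (y := z 0 7)
    (w := (- A ^+ 2 - A * B - B ^+ 2) * z 0 6 + z 0 8) d1.
- by rewrite -[RHS]V1; ring.
- by rewrite -[RHS]V2; ring.
- by rewrite -[RHS]V3; ring.
rewrite s1 mulr0 add0r => s3; by apply: row9_eq0 => //; exact/eqP.
Qed.

End SplitChange.

Section SplitChangeMap.
Variables (S S' : comNzRingType) (f : {rmorphism S -> S'}).

Lemma split_row_map (A B n1 n2 m1 m2 : S) (z : 'rV[S]_9) :
  map_mx f (split_row A B n1 n2 m1 m2 z)
  = split_row (f A) (f B) (f n1) (f n2) (f m1) (f m2) (map_mx f z).
Proof.
apply/rowP => i; rewrite !mxE /coordU /coordX /coordY !mxE.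
by case: i => [[|[|[|[|[|[|[|[|[|i]]]]]]]]] Hi] //=; ring.
Qed.

Lemma split_pt_map (A B l k n1 n2 m1 m2 x y : S) :
  ptPi_map f (split_pt A B l k n1 n2 m1 m2 x y)
  = split_pt (f A) (f B) (f l) (f k) (f n1) (f n2) (f m1) (f m2) (f x) (f y).
Proof. by rewrite /split_pt /ptPi_map /=; congr (PtPi _ _ (PtL _ _ _ _ _ _ _ _)); ring. Qed.

End SplitChangeMap.

Lemma map_unit_alg (k : comNzRingType) (S S' : comAlgType k) (f : {lrmorphism S -> S'})
  (c : k) : f (unit_alg S c) = unit_alg S' c.
Proof. by rewrite /= linearZ rmorph1. Qed.

Section SplitFibre.
Variable k : fieldType.
Variables A B l kk n1 n2 m1 m2 x y : k.
Hypothesis ABU : in_UAB A B.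

Definition split_change (S : comAlgType k) : 'rV[S]_9 -> 'rV[S]_9 :=
  split_row (unit_alg S A) (unit_alg S B) (unit_alg S n1) (unit_alg S n2)
    (unit_alg S m1) (unit_alg S m2).

Lemma disc_inv (S : comAlgType k) :
  unit_alg S ((A - B) * (2 * A + B) * (A + 2 * B))^-1 *
  ((unit_alg S A - unit_alg S B) * (2 * unit_alg S A + unit_alg S B)
    * (unit_alg S A + 2 * unit_alg S B)) = 1.
Proof.
rewrite -(rmorph1 (unit_alg S)) -[in RHS](mulVf ABU).
set e := _^-1; ring.
Qed.

Lemma split_change_coordinates : coordinate_change split_change.
Proof.
split=> [S c z z'|S S' f z|z].
- exact: split_row_linear.
- by rewrite /split_change split_row_map; congr split_row; exact: map_unit_alg.
- exact: (split_row_eq0 (disc_inv k^o)).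
Qed.

Lemma split_change_eqs (S : comAlgType k) (z : 'rV[S]_9) :
  eqPi z (ptPi_map (unit_alg S) (split_pt A B l kk n1 n2 m1 m2 x y : ptPi k^o)) = 0 <->
  tensor_eqs (split_tensor (unit_alg S l) (unit_alg S kk) (unit_alg S n1) (unit_alg S n2)
    (unit_alg S m1) (unit_alg S m2) (unit_alg S x) (unit_alg S y)) (split_change z).
Proof.
rewrite [ptPi_map _ _](split_pt_map (unit_alg S)).
exact: (split_tensor_eqs _ _ _ _ _ _ _ _ _ (disc_inv S)).
Qed.

End SplitFibre.

(** * Tensors of rank two *)

Lemma I3P (i : 'I_3) : [\/ i = 0, i = 1 | i = 2].
Proof. by case: i => [[|[|[|i]]] Hi] //; constructor; apply: val_inj. Qed.

Section MatrixIndices.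

Definition idx3 (i j : 'I_3) : 'I_9 := inord (i * 3 + j).
Definition row3 (h : 'I_9) : 'I_3 := inord (h %/ 3).
Definition col3 (h : 'I_9) : 'I_3 := inord (h %% 3).

Lemma val_idx3 i j : idx3 i j = (i * 3 + j)%N :> nat.
Proof.
rewrite inordK //; have := ltn_ord i; have := ltn_ord j.
by rewrite !ltnS => j2 i2; apply: (@leq_add _ _ 6 2) => //; rewrite (leq_mul2r 3 _ 2).
Qed.

Lemma row3K i j : row3 (idx3 i j) = i.
Proof. by rewrite /row3 val_idx3 divnMDl // divn_small // addn0 inord_val. Qed.

Lemma col3K i j : col3 (idx3 i j) = j.
Proof. by rewrite /col3 val_idx3 modnMDl modn_small // inord_val. Qed.

Lemma idx3K h : idx3 (row3 h) (col3 h) = h.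
Proof.
by apply: ord_inj; rewrite val_idx3 /row3 /col3 !inordK -?divn_eq ?ltn_mod // ltn_divLR.
Qed.

Lemma rank_one3 (S : comNzRingType) (z : 'rV[S]_9) : rank_one idx3 z <->
  [/\ [/\ z 0 0 * z 0 5 = z 0 2 * z 0 3, z 0 0 * z 0 7 = z 0 1 * z 0 6
        & z 0 4 * z 0 8 = z 0 5 * z 0 7],
      [/\ z 0 4 * z 0 6 = z 0 3 * z 0 7, z 0 4 * z 0 2 = z 0 1 * z 0 5
        & z 0 8 * z 0 0 = z 0 2 * z 0 6]
    & [/\ z 0 8 * z 0 1 = z 0 2 * z 0 7, z 0 8 * z 0 3 = z 0 5 * z 0 6
        & z 0 0 * z 0 4 = z 0 1 * z 0 3]].
Proof.
have zE (i j : 'I_3) (h : 'I_9) : (i * 3 + j)%N = h :> nat -> z 0 (idx3 i j) = z 0 h.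
  by move=> ij; congr (z _ _); apply: ord_inj; rewrite val_idx3.
have z00 := zE 0 0 0 erefl; have z01 := zE 0 1 1 erefl; have z02 := zE 0 2 2 erefl.
have z10 := zE 1 0 3 erefl; have z11 := zE 1 1 4 erefl; have z12 := zE 1 2 5 erefl.
have z20 := zE 2 0 6 erefl; have z21 := zE 2 1 7 erefl; have z22 := zE 2 2 8 erefl.
have zs := (z00, z01, z02, z10, z11, z12, z20, z21, z22).
split=> [z1|[[e1 e2 e3] [e4 e5 e6] [e7 e8 e9]]].
  split; split; rewrite -!zs.
  - exact: z1.
  - by rewrite z1.
  - exact: z1.
  - by rewrite z1.
  - by rewrite mulrC z1.
  - by rewrite mulrC z1.
  - by rewrite mulrC z1 mulrC.
  - by rewrite mulrC z1.
  - exact: z1.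
(* Each choice of indices gives a trivial identity or one of the nine minors up to sign. *)
have eqM (u v d d' : S) : d = d' -> u - v = d - d' \/ u - v = d' - d -> u = v.
  by move=> ->; rewrite subrr => -[]/eqP; rewrite subr_eq0 => /eqP.
move=> i i' j j'.
case: (I3P i) => ->; case: (I3P i') => ->; case: (I3P j) => ->; case: (I3P j') => ->;
  rewrite !zs; first [ring | match goal with e : _ * _ = _ * _ |- _ =>
    apply: (eqM _ _ _ _ e); first [left; ring | right; ring] end].
Qed.

End MatrixIndices.

Section RankTwoTensor.
Variable S : comNzRingType.

Definition det2 (a : 'M[S]_2) : S := a 0 0 * a 1 1 - a 0 1 * a 1 0.

Definition rank2_tensor (a b c : 'M[S]_2) : ptP S :=
  let T i j k := a 0 i * b 0 j * c 0 k + a 1 i * b 1 j * c 1 k in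
  PtP (T 0 0 0) (T 0 0 1) (T 0 1 0) (T 0 1 1) (T 1 0 0) (T 1 0 1) (T 1 1 0) (T 1 1 1).

(** The linear form given by row [i] of [a], evaluated at (- Y, X). *)
Definition form2 (a : 'M[S]_2) (i : 'I_2) (X Y : S) : S := a i 1 * X - a i 0 * Y.

Lemma rot_rank2_tensor (a b c : 'M[S]_2) : rot (rank2_tensor a b c) = rank2_tensor b c a.
Proof. by rewrite /rank2_tensor /rot /=; congr PtP; ring. Qed.

Lemma mul_unit_inj (d e x y : S) : d * e = 1 -> e * x = e * y -> x = y.
Proof. by move=> de exy; rewrite -[x]mul1r -[y]mul1r -de -!mulrA exy. Qed.

Lemma mul_unit_eq0 (d e x : S) : d * e = 1 -> e * x = 0 -> x = 0.
Proof. by move=> de ex; rewrite -[x]mul1r -de -mulrA ex mulr0. Qed.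

(** The combinations [f] and [g] of [eqX] and [eqY] each eliminate one of the two products of forms;
    they are reversible as [det2 a] is invertible. The contraction in [eqU] is the sum of two rank
    one matrices weighted by the forms of [a], so its determinant is a product. *)
Lemma rank2_eq3 (a b c : 'M[S]_2) (d X1 Y1 u1 X2 Y2 u2 X3 Y3 u3 : S) :
  d * det2 a = 1 ->
  eq3 (rank2_tensor a b c) X1 Y1 u1 X2 Y2 u2 X3 Y3 u3 <->
  [/\ form2 a 0 X1 Y1 * u1 = det2 a * (form2 b 1 X2 Y2 * form2 c 1 X3 Y3),
      form2 a 1 X1 Y1 * u1 = - det2 a * (form2 b 0 X2 Y2 * form2 c 0 X3 Y3)
    & u2 * u3 = - (det2 b * det2 c) * (form2 a 0 X1 Y1 * form2 a 1 X1 Y1)].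
Proof.
set T := rank2_tensor _ _ _; move=> d1.
pose f := form2 a 0 X1 Y1 * u1 - det2 a * (form2 b 1 X2 Y2 * form2 c 1 X3 Y3).
pose g := form2 a 1 X1 Y1 * u1 + det2 a * (form2 b 0 X2 Y2 * form2 c 0 X3 Y3).
have fE : f = a 0 1 * eqX T X1 u1 X2 Y2 X3 Y3 - a 0 0 * eqY T Y1 u1 X2 Y2 X3 Y3.
  by rewrite /f /T /eqX /eqY /form2 /det2 /=; ring.
have gE : g = a 1 1 * eqX T X1 u1 X2 Y2 X3 Y3 - a 1 0 * eqY T Y1 u1 X2 Y2 X3 Y3.
  by rewrite /g /T /eqX /eqY /form2 /det2 /=; ring.
have uE : eqU T X1 Y1 u2 u3 = u2 * u3
    - (- (det2 b * det2 c) * (form2 a 0 X1 Y1 * form2 a 1 X1 Y1)).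
  by rewrite /eqU /T /form2 /det2 /=; ring.
rewrite /eq3; split=> [[Ex Ey Eu]|[f0 g0 u0]].
  rewrite Ex Ey !mulr0 subrr in fE gE.
  split; apply/eqP; rewrite -subr_eq0; first by rewrite -/f fE.
    by rewrite mulNr opprK -/g gE.
  by rewrite -uE Eu.
have f1 : f = 0 by rewrite /f f0 subrr.
have g1 : g = 0 by rewrite /g g0 mulNr addNr.
split; last by rewrite uE u0 subrr.
  apply: (mul_unit_inj d1); transitivity (a 0 0 * g - a 1 0 * f).
    by rewrite fE gE /det2; ring.
  by rewrite f1 g1; ring.
apply: (mul_unit_inj d1); transitivity (a 0 1 * g - a 1 1 * f).
  by rewrite fE gE /det2; ring.
by rewrite f1 g1; ring.
Qed.

(* Writing a_i, b_i, c_i for the values of the forms, the matrix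
     [[u1, - det a c_0, det a b_1], [det b c_1, u2, det b a_0],
      [- det c b_0, - det c a_1, u3]],
   whose rows are scaled by determinants so as to avoid divisions. *)
Definition segre_row (a b c : 'M[S]_2) (y : 'rV[S]_9) : 'rV[S]_9 :=
  \row_(h < 9)
    [:: y 0 6; - det2 a * form2 c 0 (y 0 2) (y 0 5); det2 a * form2 b 1 (y 0 1) (y 0 4);
        det2 b * form2 c 1 (y 0 2) (y 0 5); y 0 7; det2 b * form2 a 0 (y 0 0) (y 0 3);
        - det2 c * form2 b 0 (y 0 1) (y 0 4); - det2 c * form2 a 1 (y 0 0) (y 0 3); y 0 8]`_h.

Lemma segre_row_linear (a b c : 'M[S]_2) e (y y' : 'rV[S]_9) :
  segre_row a b c (e *: y + y') = e *: segre_row a b c y + segre_row a b c y'.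
Proof.
apply/rowP => i; rewrite !mxE /form2.
by case: i => [[|[|[|[|[|[|[|[|[|i]]]]]]]]] Hi] //=; ring.
Qed.

Lemma form2_eq0 (a : 'M[S]_2) (d X Y : S) : d * det2 a = 1 ->
  form2 a 0 X Y = 0 -> form2 a 1 X Y = 0 -> X = 0 /\ Y = 0.
Proof.
move=> d1 f0 f1; split; apply: (mul_unit_inj d1).
  transitivity (a 0 0 * form2 a 1 X Y - a 1 0 * form2 a 0 X Y); last by rewrite f0 f1; ring.
  by rewrite /det2 /form2; ring.
transitivity (a 0 1 * form2 a 1 X Y - a 1 1 * form2 a 0 X Y); last by rewrite f0 f1; ring.
by rewrite /det2 /form2; ring.
Qed.

Lemma segre_row_eq0 (a b c : 'M[S]_2) (da db dc : S) (y : 'rV[S]_9) :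
  da * det2 a = 1 -> db * det2 b = 1 -> dc * det2 c = 1 ->
  segre_row a b c y = 0 -> y = 0.
Proof.
move=> a1 b1 c1 /rowP y0.
move: (y0 0) (y0 1) (y0 2) (y0 3) (y0 4) (y0 5) (y0 6) (y0 7) (y0 8); rewrite !mxE /= !mulNr => u1.
move=> /eqP + /(mul_unit_eq0 a1) bet1 /(mul_unit_eq0 b1) gam1 u2
  /(mul_unit_eq0 b1) alp0 /eqP + /eqP.
rewrite !oppr_eq0 => /eqP/(mul_unit_eq0 a1) gam0 /eqP/(mul_unit_eq0 c1) bet0
  /eqP/(mul_unit_eq0 c1) alp1 u3.
have [X1 Y1] := form2_eq0 a1 alp0 alp1; have [X2 Y2] := form2_eq0 b1 bet0 bet1.
have [X3 Y3] := form2_eq0 c1 gam0 gam1.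
exact: row9_eq0.
Qed.

(** Each equation, up to sign and a factor [det2], is one of the nine minors; the first argument of
    [scale] is that factor. *)
Lemma segre_row_eqs (a b c : 'M[S]_2) (da db dc : S) (y : 'rV[S]_9) :
  da * det2 a = 1 -> db * det2 b = 1 -> dc * det2 c = 1 ->
  tensor_eqs (rank2_tensor a b c) y <-> rank_one idx3 (segre_row a b c y).
Proof.
move=> a1 b1 c1; rewrite rank_one3 /tensor_eqs !rot_rank2_tensor !mxE /=.
have scale (t u v w w' : S) : w = w' -> u - v = t * (w - w') -> u = v.
  by move=> -> /eqP; rewrite subrr mulr0 subr_eq0 => /eqP.
have Ea := rank2_eq3 _ _ _ _ _ _ _ _ _ _ _ a1.
have Eb := rank2_eq3 _ _ _ _ _ _ _ _ _ _ _ b1.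
have Ec := rank2_eq3 _ _ _ _ _ _ _ _ _ _ _ c1.
split=> [[/Ea[e1 e2 e3] /Eb[e4 e5 e6] /Ec[e7 e8 e9]]|[[e1 e2 e3] [e4 e5 e6] [e7 e8 e9]]].
  split; split.
  - by apply: (scale (det2 b) _ _ _ _ e1); ring.
  - by apply: (scale (- det2 c) _ _ _ _ e2); ring.
  - by apply: (scale 1 _ _ _ _ e3); ring.
  - by apply: (scale (- det2 c) _ _ _ _ e4); ring.
  - by apply: (scale (det2 a) _ _ _ _ e5); ring.
  - by apply: (scale 1 _ _ _ _ e6); ring.
  - by apply: (scale (- det2 a) _ _ _ _ e7); ring.
  - by apply: (scale (det2 b) _ _ _ _ e8); ring.
  - by apply: (scale 1 _ _ _ _ e9); ring.
split; [apply/Ea|apply/Eb|apply/Ec]; split.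
- by apply: (mul_unit_inj b1); apply: (scale 1 _ _ _ _ e1); ring.
- by apply: (mul_unit_inj c1); apply: (scale (- 1) _ _ _ _ e2); ring.
- by apply: (scale 1 _ _ _ _ e3); ring.
- by apply: (mul_unit_inj c1); apply: (scale (- 1) _ _ _ _ e4); ring.
- by apply: (mul_unit_inj a1); apply: (scale 1 _ _ _ _ e5); ring.
- by apply: (scale 1 _ _ _ _ e6); ring.
- by apply: (mul_unit_inj a1); apply: (scale (- 1) _ _ _ _ e7); ring.
- by apply: (mul_unit_inj b1); apply: (scale 1 _ _ _ _ e8); ring.
- by apply: (scale 1 _ _ _ _ e9); ring.
Qed.

End RankTwoTensor.

Section SegreChange.
Variable k : fieldType.
Variables a b c : 'M[k]_2.

Lemma segre_row_map (S S' : comNzRingType) (f : {rmorphism S -> S'}) (a' b' c' : 'M[S]_2)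
    (y : 'rV[S]_9) :
  map_mx f (segre_row a' b' c' y)
  = segre_row (map_mx f a') (map_mx f b') (map_mx f c') (map_mx f y).
Proof.
apply/rowP => i; rewrite !mxE /form2 /det2 !mxE.
by case: i => [[|[|[|[|[|[|[|[|[|i]]]]]]]]] Hi] //=; ring.
Qed.

Definition segre_change (S : comAlgType k) : 'rV[S]_9 -> 'rV[S]_9 :=
  segre_row (base_mx S a) (base_mx S b) (base_mx S c).

Lemma det2_base_inv (S : comAlgType k) (m : 'M[k]_2) : det2 m != 0 ->
  unit_alg S (det2 m)^-1 * det2 (base_mx S m) = 1.
Proof.
move=> m0; rewrite -(rmorph1 (unit_alg S)) -[in RHS](mulVf m0) /det2 !mxE.
by set e := _^-1; ring.
Qed.

Hypotheses (a0 : det2 a != 0) (b0 : det2 b != 0) (c0 : det2 c != 0).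

Lemma segre_change_coordinates : coordinate_change segre_change.
Proof.
split=> [S e y y'|S S' f y|y]; first exact: segre_row_linear.
  by rewrite /segre_change segre_row_map; congr segre_row; exact: map_base_mx.
apply: segre_row_eq0; exact: det2_base_inv.
Qed.

Lemma segre_change_eqs (S : comAlgType k) (y : 'rV[S]_9) :
  tensor_eqs (rank2_tensor (base_mx S a) (base_mx S b) (base_mx S c)) y
  <-> rank_one idx3 (segre_change y).
Proof. by apply: segre_row_eqs; exact: det2_base_inv. Qed.

End SegreChange.

(** * The equations of P^{2,2} *)

Section SymmetricCone.
Variable S : comNzRingType.

Lemma det_mx22 (A : 'M[S]_2) : \det A = A 0 0 * A 1 1 - A 0 1 * A 1 0.
Proof.
rewrite (expand_det_row _ 0) !big_ord_recl big_ord0 /cofactor !det_mx11 !mxE /=.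
rewrite addr0 expr0 expr1 mul1r mulN1r mulrN.
by congr (_ * A _ _ - A _ _ * A _ _); apply: val_inj.
Qed.

(** Six entries are listed because [symS] reads only the first six coordinates. *)
Lemma adj_symS (z : 'rV[S]_9) : \adj (symS z) = symS (\row_(h < 9)
  [:: z 0 3 * z 0 5 - z 0 4 ^+ 2; z 0 2 * z 0 4 - z 0 1 * z 0 5; z 0 1 * z 0 4 - z 0 2 * z 0 3;
      z 0 0 * z 0 5 - z 0 2 ^+ 2; z 0 1 * z 0 2 - z 0 0 * z 0 4; z 0 0 * z 0 3 - z 0 1 ^+ 2]`_h).
Proof.
apply/matrixP; case=> [[|[|[|i]]] Hi] //; case=> [[|[|[|j]]] Hj] //;
  rewrite !mxE /cofactor det_mx22 !mxE /=; ring.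
Qed.

Lemma symS_eq0 (z : 'rV[S]_9) : symS z = 0 <->
  [/\ z 0 0 = 0, z 0 1 = 0 & z 0 2 = 0] /\ [/\ z 0 3 = 0, z 0 4 = 0 & z 0 5 = 0].
Proof.
split=> [/matrixP z0|[[e0 e1 e2] [e3 e4 e5]]].
  by move: (z0 0 0) (z0 0 1) (z0 0 2) (z0 1 1) (z0 1 2) (z0 2 2); rewrite !mxE.
by apply/matrixP; case=> [[|[|[|i]]] Hi] //; case=> [[|[|[|j]]] Hj] //; rewrite !mxE.
Qed.

Lemma symS_sigma_eq0 (z : 'rV[S]_9) : symS z *m sigma z = 0 <->
  [/\ z 0 0 * z 0 6 + z 0 1 * z 0 7 + z 0 2 * z 0 8 = 0,
      z 0 1 * z 0 6 + z 0 3 * z 0 7 + z 0 4 * z 0 8 = 0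
    & z 0 2 * z 0 6 + z 0 4 * z 0 7 + z 0 5 * z 0 8 = 0].
Proof.
split=> [/colP z0|[e0 e1 e2]].
  move: (z0 0) (z0 1) (z0 2); rewrite !mxE !big_ord_recl !big_ord0 !mxE /= !addr0 !addrA.
  by split.
apply/colP; case=> [[|[|[|i]]] Hi] //;
  by rewrite !mxE !big_ord_recl big_ord0 !mxE /= addr0 addrA.
Qed.

(* S = [[u1, - Y3, - Y2], [- Y3, u2, - Y1], [- Y2, - Y1, u3]] and sigma = (X1, X2, X3). *)
Definition sym_row (y : 'rV[S]_9) : 'rV[S]_9 :=
  \row_(h < 9) [:: y 0 6; - y 0 5; - y 0 4; y 0 7; - y 0 3; y 0 8; y 0 0; y 0 1; y 0 2]`_h.

Lemma sym_row_linear c (y y' : 'rV[S]_9) :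
  sym_row (c *: y + y') = c *: sym_row y + sym_row y'.
Proof.
apply/rowP => i; rewrite !mxE.
by case: i => [[|[|[|[|[|[|[|[|[|i]]]]]]]]] Hi] //=; ring.
Qed.

Lemma sym_row_eq0 (y : 'rV[S]_9) : sym_row y = 0 -> y = 0.
Proof.
move=> /rowP y0.
move: (y0 0) (y0 1) (y0 2) (y0 3) (y0 4) (y0 5) (y0 6) (y0 7) (y0 8).
rewrite !mxE /= => u1 /eqP + /eqP + u2 /eqP + u3 X1 X2 X3.
rewrite !oppr_eq0 => /eqP Y3 /eqP Y2 /eqP Y1.
exact: row9_eq0.
Qed.

(** For this tensor, [eqX] gives the rows of S sigma, [eqY] the off-diagonal entries of the adjugate
    and [eqU] its diagonal entries, all up to sign. *)
Lemma sym_row_eqs (y : 'rV[S]_9) :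
  tensor_eqs (split_tensor 1 0 0 0 0 0 0 0) y <->
  \adj (symS (sym_row y)) = 0 /\ symS (sym_row y) *m sigma (sym_row y) = 0.
Proof.
rewrite adj_symS symS_eq0 symS_sigma_eq0 !mxE /= /tensor_eqs /eq3 /eqX /eqY /eqU /=.
have opp (u v : S) : u = 0 -> v = - u -> v = 0 by move=> -> ->; rewrite oppr0.
have same (u v : S) : u = 0 -> v = u -> v = 0 by move=> -> ->.
split=> [[[e1 e2 e3] [e4 e5 e6] [e7 e8 e9]]|[[[e1 e2 e3] [e4 e5 e6]] [e7 e8 e9]]].
  split; split; (try split);
    match goal with
    | e : _ = _ |- _ => solve [apply: (same _ _ e); ring | apply: (opp _ _ e); ring]
    end.
split; split;
  match goal with
  | e : _ = _ |- _ => solve [apply: (same _ _ e); ring | apply: (opp _ _ e); ring]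
  end.
Qed.

End SymmetricCone.

Lemma sym_row_map (S S' : comNzRingType) (f : {rmorphism S -> S'}) (y : 'rV[S]_9) :
  map_mx f (sym_row y) = sym_row (map_mx f y).
Proof.
apply/rowP => i; rewrite !mxE.
by case: i => [[|[|[|[|[|[|[|[|[|i]]]]]]]]] Hi] //=; rewrite rmorphN.
Qed.

Lemma sym_row_coordinates (k : fieldType) :
  coordinate_change (fun (S : comAlgType k) (y : 'rV[S]_9) => sym_row y).
Proof.
split=> [S c y y'|S S' f y|y]; first exact: sym_row_linear.
  exact: sym_row_map.
exact: sym_row_eq0.
Qed.

(** * The hyperdeterminant *)

(** The tensor [LtoP] is three times [split_tensor], and the hyperdeterminant has degree four,
    whence 81 = 3^4. *)
Lemma bmap_split (k : fieldType) (A B : k) (L : ptL k) : in_UAB A B ->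
  exists l kk n1 n2 m1 m2 x y, bmap A B L = split_pt A B l kk n1 n2 m1 m2 x y /\
    hyperdet (LtoP A B L) = 81 * hyperdet (split_tensor l kk n1 n2 m1 m2 x y).
Proof.
rewrite /in_UAB !mulf_eq0 !negb_or => /andP[/andP[AB AB2] A2B].
case: L => L123 L124 L125 L126 L135 L136 L245 L246.
exists L245, L136, ((L124 - A * L126) / ((A - B) * (2 * A + B))),
  ((- L124 + B * L126) / ((A - B) * (A + 2 * B))),
  ((L123 - A * L125) / ((A - B) * (2 * A + B))),
  ((- L123 + B * L125) / ((A - B) * (A + 2 * B))), (- L246), L135.
split.
  rewrite /bmap /split_pt /=; congr (PtPi _ _ (PtL _ _ _ _ _ _ _ _));
    by [field; rewrite ?AB ?AB2 ?A2B | rewrite opprK].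
set e := split_tensor _ _ _ _ _ _ _ _.
have -> : LtoP A B (PtL L123 L124 L125 L126 L135 L136 L245 L246) =
    PtP (3 * p111 e) (3 * p112 e) (3 * p121 e) (3 * p122 e)
        (3 * p211 e) (3 * p212 e) (3 * p221 e) (3 * p222 e).
  by rewrite /LtoP /e /=; congr PtP; field; rewrite ?AB ?AB2 ?A2B.
by case: e => ????????; rewrite /hyperdet /=; ring.
Qed.

(** The hyperdeterminant is a relative invariant of GL_2 x GL_2 x GL_2 of weight two in each
    determinant, with value 1 when [a], [b], [c] are identity matrices. *)
Lemma hyperdet_rank2 (k : fieldType) (a b c : 'M[k]_2) :
  hyperdet (rank2_tensor a b c) = (det2 a * det2 b * det2 c) ^+ 2.
Proof. by rewrite /hyperdet /rank2_tensor /det2; ring. Qed.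

Lemma rank1_mx22 (k : fieldType) (p q r s : k) : p * s = q * r ->
  exists f0 f1 g0 g1, [/\ p = f0 * g0, q = f0 * g1, r = f1 * g0 & s = f1 * g1].
Proof.
move=> psqr; have [p0|p0] := eqVneq p 0; last first.
  exists 1, (r / p), p, q; split; rewrite ?mul1r ?divfK //.
  by apply: (mulfI p0); rewrite psqr; field.
move/esym/eqP: psqr; rewrite p0 mul0r mulf_eq0 => /orP[]/eqP-> .
  by exists 0, 1, r, s; rewrite !mul0r !mul1r.
by exists q, s, 0, 1; rewrite !mulr0 !mulr1.
Qed.

Lemma binary_form_isotropic (k : numClosedFieldType) (P Q R : k) : Q ^+ 2 - 4 * P * R != 0 ->
  exists v0 v1 w0 w1, [/\ P * v0 ^+ 2 + Q * v0 * v1 + R * v1 ^+ 2 = 0,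
    P * w0 ^+ 2 + Q * w0 * w1 + R * w1 ^+ 2 = 0 & v0 * w1 - v1 * w0 != 0].
Proof.
have [->|P0] := eqVneq P 0 => disc.
  (* For P = 0 the form is v1 (Q v0 + R v1); otherwise the quadratic formula is used, in homogeneous
     form. *)
  exists 1, 0, (- R), Q; split; [ring | ring |].
  by move: disc; rewrite mulr0 !mul0r subr0 sqrf_eq0 mul1r subr0.
pose s := sqrtC (Q ^+ 2 - 4 * P * R).
have sE : s ^+ 2 = Q ^+ 2 - 4 * P * R by exact: sqrtCK.
exists (- Q + s), (2 * P), (- Q - s), (2 * P); split.
- by transitivity (P * (s ^+ 2 - (Q ^+ 2 - 4 * P * R))); [ring | rewrite sE subrr mulr0].
- by transitivity (P * (s ^+ 2 - (Q ^+ 2 - 4 * P * R))); [ring | rewrite sE subrr mulr0].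
have -> : (- Q + s) * (2 * P) - 2 * P * (- Q - s) = 4 * P * s by ring.
by rewrite !mulf_neq0 ?pnatr_eq0 // -sqrf_eq0 sE.
Qed.

(** The hyperdeterminant is the discriminant of the determinant of the pencil x0 e_1jk + x1 e_2jk.
    Its two distinct zeros give two rank one members of the pencil, and these span both slices. *)
Lemma hyperdet_neq0_rank2 (k : numClosedFieldType) (e : ptP k) : hyperdet e != 0 ->
  exists a b c, [/\ e = rank2_tensor a b c, det2 a != 0, det2 b != 0 & det2 c != 0].
Proof.
move=> e0; suff [a [b [c eE]]] : exists a b c, e = rank2_tensor a b c.
  by exists a, b, c; move: e0; rewrite eE hyperdet_rank2 sqrf_eq0 !mulf_eq0 !negb_or
    => /andP[/andP[-> ->] ->].
case: e e0 => e111 e112 e121 e122 e211 e212 e221 e222 e0.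
have [] := @binary_form_isotropic k (e111 * e122 - e112 * e121)
  (e111 * e222 + e211 * e122 - e112 * e221 - e212 * e121) (e211 * e222 - e212 * e221).
  by apply: contraNneq e0 => <-; rewrite /hyperdet; apply/eqP; ring.
move=> v0 [v1 [w0 [w1 [qv qw D]]]].
have slice x0 x1 : (e111 * e122 - e112 * e121) * x0 ^+ 2 +
    (e111 * e222 + e211 * e122 - e112 * e221 - e212 * e121) * x0 * x1
    + (e211 * e222 - e212 * e221) * x1 ^+ 2 = 0 ->
    exists f0 f1 g0 g1, [/\ x0 * e111 + x1 * e211 = f0 * g0, x0 * e112 + x1 * e212 = f0 * g1,
      x0 * e121 + x1 * e221 = f1 * g0 & x0 * e122 + x1 * e222 = f1 * g1].
  move=> qx; apply: rank1_mx22; apply/eqP; rewrite -subr_eq0; apply/eqP.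
  by rewrite -[RHS]qx; ring.
have [b0 [b1 [c0 [c1 [v11 v12 v21 v22]]]]] := slice _ _ qv.
have [b0' [b1' [c0' [c1' [w11 w12 w21 w22]]]]] := slice _ _ qw.
pose mx p q r s : 'M[k]_2 := \matrix_(i, j) if i == 0 then if j == 0 then p else q
                                           else if j == 0 then r else s.
(* The inverse transpose of the matrix with rows v and w, which expresses the slices through the two
   rank one members. *)
exists (mx (w1 / (v0 * w1 - v1 * w0)) (- w0 / (v0 * w1 - v1 * w0))
           (- v1 / (v0 * w1 - v1 * w0)) (v0 / (v0 * w1 - v1 * w0))),
  (mx b0 b1 b0' b1'), (mx c0 c1 c0' c1').
rewrite /rank2_tensor !mxE /= -!mulrA -v11 -v12 -v21 -v22 -w11 -w12 -w21 -w22.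
by congr PtP; field.
Qed.

(** Take A as a root of x^3 + t x - t', then B as a root of the quotient x^2 + A x + A^2 + t. The
    third root is - A - B. *)
Lemma split_cubic (k : numClosedFieldType) (t t' : k) : 4 * t ^+ 3 + 27 * t' ^+ 2 != 0 ->
  exists A B, [/\ in_UAB A B, t = - A ^+ 2 - A * B - B ^+ 2 & t' = - (A * B * (A + B))].
Proof.
move=> disc.
have [A AE] := @solve_monicpoly k 3 (fun i => nth 0 [:: t'; - t; 0] i) isT.
have [B BE] := @solve_monicpoly k 2 (fun i => nth 0 [:: - (A ^+ 2 + t); - A] i) isT.
move: AE BE; rewrite !big_ord_recl !big_ord0 /= => AE BE.
have tE : t = - A ^+ 2 - A * B - B ^+ 2 by rewrite BE /bump /=; ring.
have t'E : t' = - (A * B * (A + B)).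
  by transitivity (A ^+ 3 + t * A); [rewrite AE /bump /=; ring | rewrite tE; ring].
(* The square of the product in [in_UAB] is the discriminant - (4 t^3 + 27 t'^2). *)
exists A, B; split=> //; rewrite /in_UAB -sqrf_eq0 -oppr_eq0.
by rewrite (_ : - _ = 4 * t ^+ 3 + 27 * t' ^+ 2) // tE t'E; ring.
Qed.

(** * The two types of fibres *)

Definition ptP_map (S S' : Type) (f : S -> S') (e : ptP S) : ptP S' :=
  PtP (f (p111 e)) (f (p112 e)) (f (p121 e)) (f (p122 e))
      (f (p211 e)) (f (p212 e)) (f (p221 e)) (f (p222 e)).

Section TensorMap.
Variables (S S' : comNzRingType) (f : {rmorphism S -> S'}).

Lemma split_tensor_map (l k n1 n2 m1 m2 x y : S) :
  ptP_map f (split_tensor l k n1 n2 m1 m2 x y)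
  = split_tensor (f l) (f k) (f n1) (f n2) (f m1) (f m2) (f x) (f y).
Proof. by rewrite /ptP_map /split_tensor /=; congr PtP; ring. Qed.

Lemma rank2_tensor_map (a b c : 'M[S]_2) :
  ptP_map f (rank2_tensor a b c) = rank2_tensor (map_mx f a) (map_mx f b) (map_mx f c).
Proof. by rewrite /ptP_map /rank2_tensor !mxE /=; congr PtP; ring. Qed.

End TensorMap.

Lemma fibre_P2_P2 (k : numClosedFieldType) (a : ptPi k) :
  4 * t1 a ^+ 3 + 27 * t2 a ^+ 2 != 0 -> ~ Hprime a ->
  isomorphic (fibre (rhoPi k) a) (prodF (Proj k 2) (Proj k 2)).
Proof.
move=> /split_cubic[A [B [ABU tE t'E]]] Ha.
have aE : bmap A B (ptPi_L a) = a by rewrite /bmap -tE -t'E; case: (a).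
have [l [kk [n1 [n2 [m1 [m2 [x [y [ptE hypE]]]]]]]]] := bmap_split (ptPi_L a) ABU.
have [|al [be [ga [eE al0 be0 ga0]]]] :=
    @hyperdet_neq0_rank2 k (split_tensor l kk n1 n2 m1 m2 x y).
  (* A zero hyperdeterminant of [split_tensor] would put [a] in [Hprime], with the same A, B. *)
  apply/eqP => e0; apply: Ha; exists A, B, (ptPi_L a); split=> //.
  by rewrite hypE e0 mulr0.
have segre := segre_embedding k row3K col3K idx3K.
apply: isomorphic_trans (isomorphic_sym segre).
apply: (fibre_coordinate_change (on_segre_fmap (idx := idx3))
  (coordinate_change_comp (split_change_coordinates n1 n2 m1 m2 ABU)
    (segre_change_coordinates al0 be0 ga0))) => S z.
rewrite -[in X in X <-> _]aE ptE.
apply: iff_trans (split_change_eqs l kk n1 n2 m1 m2 x y ABU z) _.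
apply: iff_trans (segre_change_eqs al0 be0 ga0 _).
by rewrite -(split_tensor_map (unit_alg S)) -(rank2_tensor_map (unit_alg S)) eE.
Qed.

(** The roots are 1, - 1, 0, so t1 = - 1 and t2 = 0, and L245 = 1 is the only nonzero L. The
    associated tensor has p112 = p121 = p211 = 1 and zeros elsewhere. *)
Lemma fibre_P22 (k : numClosedFieldType) :
  isomorphic (fibre (rhoPi k) (split_pt 1 (- 1) 1 0 0 0 0 0 0 0)) (P22 k).
Proof.
have U : @in_UAB k 1 (- 1).
  rewrite /in_UAB (_ : _ * _ = - 2); last by ring.
  by rewrite oppr_eq0 pnatr_eq0.
apply: (fibre_coordinate_change (@on_P22_fmap k)
  (coordinate_change_comp (split_change_coordinates 0 0 0 0 U)
    (sym_row_coordinates k))) => S z.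
apply: iff_trans (split_change_eqs 1 0 0 0 0 0 0 0 U z) _.
apply: iff_trans (sym_row_eqs _).
by rewrite !(rmorph0 (unit_alg S)) (rmorph1 (unit_alg S)).
Qed.

Lemma Hprime_W (k : numClosedFieldType) :
  Hprime (split_pt 1 (- 1) 1 0 0 0 0 0 0 0 : ptPi k).
Proof.
pose a : ptPi k := split_pt 1 (- 1) 1 0 0 0 0 0 0 0.
exists 1, (- 1), (ptPi_L a); split=> //.
  rewrite /in_UAB (_ : _ * _ = - 2); last by ring.
  by rewrite oppr_eq0 pnatr_eq0.
rewrite /hyperdet /LtoP /=; ring.
Qed.

Theorem proposition10p1 (R : realType) :
  (forall a : ptPi R[i], 4 * t1 a ^+ 3 + 27 * t2 a ^+ 2 != 0 ->  ~ Hprime a ->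
     isomorphic (fibre (rhoPi R[i]) a) (prodF (Proj R[i] 2) (Proj R[i] 2)))
  /\
  (exists T : set (ptPi R[i]),
     [/\ T !=set0, T `<=` @Hprime R[i]
       & forall a : ptPi R[i], T a ->
           isomorphic (fibre (rhoPi R[i]) a) (P22 R[i])]).
Proof.
split=> [a|]; first exact: fibre_P2_P2.
pose a0 : ptPi R[i] := split_pt 1 (- 1) 1 0 0 0 0 0 0 0.
exists [set a0]; split=> [|_ ->|_ ->]; first by exists a0.
  exact: Hprime_W.
exact: fibre_P22.
Qed.
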